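(* Let $k$ be a commutative ring with identity and $\mathcal{A}$ a unital (associative, not necessarily commutative) graded $k$-algebra which is free as a $k$-module. Let $P_{n+1}$ be the $(n+1)$-gon, $n\ge 1$. Then: (a) $\hat H^{i,j}_{\mathcal{A}}(P_{n+1})\cong HH_{n-i,j}(\mathcal{A})$ for $0<i\le n$ and every $j$. (b) If $\mathcal{A}$ is commutative, then $H^{i,j}_{\mathcal{A}}(P_{n+1})\cong\hat H^{i,j}_{\mathcal{A}}(P_{n+1})$ for $0<i<n$ and every $j$; moreover $H^{n,*}_{\mathcal{A}}(P_{n+1})=0$ and $\hat H^{n,*}_{\mathcal{A}}(P_{n+1})\cong HH_{0,*}(\mathcal{A})\cong\mathcal{A}$ as graded $k$-modules. (c) For general $\mathcal{A}$, $\hat H^{n,*}_{\mathcal{A}}(P_{n+1})\cong HH_{0,*}(\mathcal{A})\cong\mathcal{A}/(ab-ba)$ as graded $k$-modules, where $(ab-ba)$ denotes the $k$-submodule generated by all commutators $ab-ba$, $a,b\in\mathcal{A}$.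
   Context: All tensor products are over $k$. **Hochschild homology.** $C_r(\mathcal{A})=\mathcal{A}\otimes\mathcal{A}^{\otimes r}$ with boundary $b=\sum_{i=0}^r(-1)^id_i$, where $d_i(a_0,a_1,\dots,a_r)=(a_0,\dots,a_ia_{i+1},\dots,a_r)$ for $0\le i\le r-1$ and $d_r(a_0,\dots,a_r)=(a_ra_0,a_1,\dots,a_{r-1})$. $HH_r(\mathcal{A})$ is its $r$-th homology. **Graph cohomology of the directed polygon.** For $N\ge 2$, $P_N$ is the cycle with $N$ vertices $v_0,\dots,v_{N-1}$ and $N$ edges, directed anticlockwise: $e_j$ goes from $v_{j-1}$ to $v_j$ (indices mod $N$), $j=1,\dots,N$. Let $E$ be the set of edges. For $s\subset E$ let $[P_N:s]$ be the subgraph with all vertices and edge set $s$, and let $k(s)$ be its number of connected components. List the components in cyclic order following the orientation, starting with the one containing $v_0$. Put $\hat\Phi(s)=\mathcal{A}^{\otimes k(s)}$, with one copy of $\mathcal{A}$ attached to each component in this order; an element of the copy attached to a component is called its weight. For $e\in E\setminus s$ define $\hat\Phi(s\subset s\cup e):\hat\Phi(s)\to\hat\Phi(s\cup e)$ as follows. If $e$ joins two different components of $[P_N:s]$, with $x$ the weight of the component containing the initial vertex of $e$ and $y$ the weight of the component containing the terminal vertex of $e$, then the merged component receives the weight $xy$, other weights being unchanged. If both endpoints of $e$ lie in the same component of $[P_N:s]$, then the map is zero. The cochain complex is $C^i=\bigoplus_{|s|=i}\hat\Phi(s)$ with differential which on $\hat\Phi(s)$ is $d=\sum_{e\notin s}(-1)^{t(s,e)}\hat\Phi(s\subset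 s\cup e)$, where $E$ is given a fixed linear ordering and $t(s,e)$ is the number of elements of $s$ smaller than $e$. Its cohomology is $\hat H^i_{\mathcal{A}}(P_N)$. When $\mathcal{A}$ is commutative, $H^i_{\mathcal{A}}(P_N)$ is the cohomology of the complex defined in the same way, except that when both endpoints of $e$ lie in the same component of $[P_N:s]$ the map for $s\subset s\cup e$ is the identity map instead of zero. **Gradings.** All complexes are graded by total degree in the tensor powers of the graded algebra $\mathcal{A}$; the (co)boundaries preserve this degree. The second index $j$ denotes the part of internal degree $j$, and $*$ in its place denotes the whole graded module. *)

(* Defs.v *)
From HB Require Import structures.
From mathcomp Require Import all_boot all_order all_algebra.
From mathcomp Require Import boolp.
From mathcomp Require Import zify finmap monalg.

Set Implicit Arguments.
Unset Strict Implicit.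
Unset Printing Implicit Defensive.

Import GRing.Theory.
Local Open Scope ring_scope.
Local Open Scope quotient_scope.

Section Modules.
Variable k : comNzRingType.

Record submodule (V : lmodType k) := Submodule
  { submod_mem :> {pred V}; submod_memP : GRing.submod_closed submod_mem }.

HB.instance Definition _ V (S : submodule V) :=
  GRing.isSubmodClosed.Build k V (submod_mem S) (submod_memP S).

(* Membership in mathcomp's submodules is boolean; [`[< P >]] is the classical
   truth value of [P]. *)
Definition submodule_of (V : lmodType k) (P : V -> Prop) (P0 : P 0)
  (PL : forall a x y, P x -> P y -> P (a *: x + y)) : submodule V.
Proof.
exists [pred x | `[< P x >]]; split; first exact/asboolP.
by move=> a x y /asboolP Px /asboolP Py; apply/asboolP/PL.
Defined.

Lemma submodule_ofE (V : lmodType k) (P : V -> Prop) P0 PL x :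
  (x \in @submodule_of V P P0 PL) <-> P x.
Proof. by split=> /asboolP. Qed.

Definition submod (V : lmodType k) (S : submodule V) : Type := {x : V | x \in S}.
HB.instance Definition _ V (S : submodule V) := SubChoice.on (submod S).
HB.instance Definition _ V (S : submodule V) :=
  [SubChoice_isSubLmodule of submod S by <:].

Section Quotient.
Variables (V : lmodType k) (S : submodule V).

Definition quotmod : Type := {ideal_quot (submod_mem S)}.
HB.instance Definition _ := Choice.on quotmod.
HB.instance Definition _ := GRing.Zmodule.on quotmod.
HB.instance Definition _ := EqQuotient.on quotmod.

Definition quot_scale (a : k) (q : quotmod) : quotmod := \pi_quotmod (a *: repr q).

Definition quot_pi (x : V) : quotmod := \pi_quotmod x.

Lemma quot_piP x y : reflect (quot_pi x = quot_pi y) (x - y \in S).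
Proof. by rewrite [X in reflect _ X]Quotient.idealrBE; apply: eqP. Qed.

Lemma quot_pi_reprK q : quot_pi (repr q) = q.
Proof. exact: reprK. Qed.

Lemma quot_piD : {morph quot_pi : x y / x + y}.
Proof. exact: (Quotient.pi_add (submod_mem S)). Qed.

Lemma quot_scale_pi a x : quot_scale a (quot_pi x) = quot_pi (a *: x).
Proof.
apply/quot_piP; rewrite -scalerBr; apply: rpredZ.
by apply/quot_piP; rewrite quot_pi_reprK.
Qed.

Fact quot_scaleA a b q : quot_scale a (quot_scale b q) = quot_scale (a * b) q.
Proof. by rewrite -(quot_pi_reprK q) !quot_scale_pi scalerA. Qed.
Fact quot_scale1 : left_id 1 quot_scale.
Proof. by move=> q; rewrite -(quot_pi_reprK q) quot_scale_pi scale1r. Qed.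
Fact quot_scaleDr : right_distributive quot_scale +%R.
Proof.
move=> a p q; rewrite -(quot_pi_reprK p) -(quot_pi_reprK q).
by rewrite -quot_piD !quot_scale_pi -quot_piD scalerDr.
Qed.
Fact quot_scaleDl q : {morph quot_scale^~ q : a b / a + b}.
Proof.
move=> a b; rewrite -(quot_pi_reprK q) !quot_scale_pi -quot_piD.
by rewrite scalerDl.
Qed.
HB.instance Definition _ := GRing.Zmodule_isLmodule.Build k quotmod
  quot_scaleA quot_scale1 quot_scaleDr quot_scaleDl.

Fact quot_pi_is_linear : linear quot_pi.
Proof. by move=> a x y; rewrite quot_piD -quot_scale_pi. Qed.
HB.instance Definition _ :=
  GRing.isLinear.Build k V quotmod *:%R quot_pi quot_pi_is_linear.

End Quotient.

Definition submod_span (V : lmodType k) (P : V -> Prop) : submodule V.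
Proof.
apply: (@submodule_of V (fun x =>
  forall S : submodule V, (forall y, P y -> y \in S) -> x \in S)).
- by move=> S _; apply: rpred0.
- by move=> a x y Sx Sy S PS; apply: rpredD; [apply/rpredZ/Sx | apply: Sy].
Defined.

Lemma submod_spanP (V : lmodType k) (P : V -> Prop) (x : V) :
  (x \in submod_span P) <-> (forall S : submodule V, (forall y, P y -> y \in S) -> x \in S).
Proof. exact: submodule_ofE. Qed.

(* The image in [V / S] of a submodule of [V]. *)
Definition quot_image (V : lmodType k) (S D : submodule V) :
  submodule (quotmod S).
Proof.
apply: (@submodule_of _ (fun q => exists2 x, x \in D & q = quot_pi S x)).
- by exists 0; rewrite ?rpred0 ?linear0.
- move=> a _ _ [x Dx ->] [y Dy ->]; exists (a *: x + y); last by rewrite linearP.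
  by apply: rpredD => //; apply: rpredZ.
Defined.

Definition submod_restrict (V : lmodType k) (Z B : submodule V) : submodule (submod Z).
Proof.
apply: (@submodule_of _ (fun x : submod Z => val x \in B)).
- exact: rpred0.
- by move=> a x y Bx By; rewrite linearP /= rpredD // rpredZ.
Defined.

(* Z / (Z ∩ B), which is Z / B as soon as B is contained in Z. *)
Definition subquot (V : lmodType k) (Z B : submodule V) : lmodType k :=
  quotmod (submod_restrict Z B).

Definition lmod_iso (M N : lmodType k) : Prop :=
  exists f : {linear M -> N}, bijective f.

(* A k-module with, for each integer j, its part of degree j. *)
Record grmod := GrMod { gr_sort :> lmodType k; gr_deg : int -> submodule gr_sort }.

Definition deg_part (M : grmod) (j : int) : lmodType k := submod (gr_deg M j).

Definition gr_iso (M N : grmod) : Prop :=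
  exists f : {linear M -> N},
    bijective f /\ forall j x, (x \in gr_deg M j) = (f x \in gr_deg N j).

Definition gr_quot (M : grmod) (S : submodule M) : grmod :=
  @GrMod (quotmod S) (fun j => quot_image S (gr_deg M j)).

Definition gr_subquot (M : grmod) (Z B : submodule M) : grmod :=
  @GrMod (subquot Z B)
    (fun j => quot_image (submod_restrict Z B) (submod_restrict Z (gr_deg M j))).

Definition free_module (V : lmodType k) : Prop :=
  exists B : V -> Prop,
    (forall x, x \in submod_span B) /\
    (forall (r : seq V) (c : V -> k), uniq r -> (forall v, v \in r -> B v) ->
       \sum_(v <- r) c v *: v = 0 -> forall v, v \in r -> c v = 0).

Definition direct_sum (I : finType) (V : I -> lmodType k) : Type :=
  {dffun forall i, V i}.

Section DirectSum.
Variables (I : finType) (V : I -> lmodType k).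
Local Notation DS := (direct_sum V).
HB.instance Definition _ := Choice.on DS.

Definition ds_make (f : forall i, V i) : DS := [ffun i => f i].
Definition ds_coord (i : I) (x : DS) : V i := x i.

Lemma ds_makeE f i : ds_coord i (ds_make f) = f i.
Proof. exact: ffunE. Qed.

Lemma ds_eqP (x y : DS) : (forall i, ds_coord i x = ds_coord i y) <-> x = y.
Proof. by split=> [H|-> //]; apply/ffunP. Qed.

Definition ds_add (x y : DS) : DS := ds_make (fun i => ds_coord i x + ds_coord i y).
Definition ds_opp (x : DS) : DS := ds_make (fun i => - ds_coord i x).
Definition ds_zero : DS := ds_make (fun i => 0).
Definition ds_scale (a : k) (x : DS) : DS := ds_make (fun i => a *: ds_coord i x).

Fact ds_addA : associative ds_add.
Proof. by move=> x y z; apply/ds_eqP => i; rewrite !ds_makeE addrA. Qed.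
Fact ds_addC : commutative ds_add.
Proof. by move=> x y; apply/ds_eqP => i; rewrite !ds_makeE addrC. Qed.
Fact ds_add0 : left_id ds_zero ds_add.
Proof. by move=> x; apply/ds_eqP => i; rewrite !ds_makeE add0r. Qed.
Fact ds_addN : left_inverse ds_zero ds_opp ds_add.
Proof. by move=> x; apply/ds_eqP => i; rewrite !ds_makeE addNr. Qed.
HB.instance Definition _ :=
  GRing.isZmodule.Build DS ds_addA ds_addC ds_add0 ds_addN.

Fact ds_scaleA a b x : ds_scale a (ds_scale b x) = ds_scale (a * b) x.
Proof. by apply/ds_eqP => i; rewrite !ds_makeE scalerA. Qed.
Fact ds_scale1 : left_id 1 ds_scale.
Proof. by move=> x; apply/ds_eqP => i; rewrite !ds_makeE scale1r. Qed.
Fact ds_scaleDr : right_distributive ds_scale +%R.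
Proof. by move=> a x y; apply/ds_eqP => i; rewrite !ds_makeE scalerDr. Qed.
Fact ds_scaleDl x : {morph ds_scale^~ x : a b / a + b}.
Proof. by move=> a b; apply/ds_eqP => i; rewrite !ds_makeE scalerDl. Qed.
HB.instance Definition _ := GRing.Zmodule_isLmodule.Build k DS
  ds_scaleA ds_scale1 ds_scaleDr ds_scaleDl.

Fact ds_coord_is_linear i : linear (ds_coord i).
Proof. by move=> a x y; rewrite /ds_coord !ffunE [ds_coord _ _]ffunE. Qed.
HB.instance Definition _ i :=
  GRing.isLinear.Build k DS (V i) *:%R (ds_coord i) (ds_coord_is_linear i).

(* The inclusion of the i-th summand: x in coordinate i and 0 elsewhere. *)
Definition ds_inj (i : I) (x : V i) : DS :=
  ds_make (fun j => if i =P j is ReflectT ij then ecast j (V j) ij x else 0).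

Lemma ds_inj_eq i x : ds_coord i (@ds_inj i x) = x.
Proof. by rewrite ds_makeE; case: eqP => // e; rewrite eq_axiomK. Qed.

Lemma ds_inj_neq i j x : i != j -> ds_coord j (@ds_inj i x) = 0.
Proof. by move=> ij; rewrite ds_makeE; case: eqP ij => // ->; rewrite eqxx. Qed.

Fact ds_inj_is_linear i : linear (@ds_inj i).
Proof.
move=> a x y; apply/ds_eqP => j; rewrite linearP /=.
case: (eqVneq i j) => [<-|ij]; first by rewrite !ds_inj_eq.
by rewrite !ds_inj_neq // scaler0 addr0.
Qed.
HB.instance Definition _ i :=
  GRing.isLinear.Build k (V i) DS *:%R (@ds_inj i) (@ds_inj_is_linear i).

End DirectSum.

End Modules.

Section TensorPower.
Variables (k : comNzRingType) (A : lmodType k).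

Definition upd (m : nat) (w : {ffun 'I_m -> A}) (i : 'I_m) (x : A) :
  {ffun 'I_m -> A} := [ffun c => if c == i then x else w c].

Definition multilinear (m : nat) (V : lmodType k) (phi : {ffun 'I_m -> A} -> V) :=
  forall w i a x y, phi (upd w i (a *: x + y)) =
                    a *: phi (upd w i x) + phi (upd w i y).

Definition multilinear_rel (m : nat) (z : {malg k[{ffun 'I_m -> A}]}) : Prop :=
  exists w i a x y,
    z = << upd w i (a *: x + y) >> - (a *: << upd w i x >> + << upd w i y >>).

(* The m-th tensor power over k: the free module on A^m modulo the
   multilinearity relations. *)
Definition tpow (m : nat) : lmodType k :=
  quotmod (submod_span (@multilinear_rel m)).

Definition tens (m : nat) (w : {ffun 'I_m -> A}) : tpow m := quot_pi _ << w >>.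

Lemma tens_multilinear m : multilinear (@tens m).
Proof.
move=> w i a x y; rewrite /tens -linearP; apply/quot_piP.
apply/submod_spanP => S; apply; by exists w, i, a, x, y.
Qed.

Section Lift.
Variables (m : nat) (V : lmodType k) (phi : {ffun 'I_m -> A} -> V).

Definition free_lift (z : {malg k[{ffun 'I_m -> A}]}) : V :=
  \sum_(w <- msupp z) z@_w *: phi w.

Lemma free_liftEw (D : {fset {ffun 'I_m -> A}}) z : (msupp z `<=` D)%fset ->
  free_lift z = \sum_(w <- D) z@_w *: phi w.
Proof.
move=> zD; rewrite /free_lift; rewrite (big_fset_incl _ zD) //=.
by move=> w _ /mcoeff_outdom ->; rewrite scale0r.
Qed.

Fact free_lift_is_linear : linear free_lift.
Proof.
move=> a x y; pose D := (msupp x `|` msupp y `|` msupp (a *: x + y))%fset.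
rewrite !(@free_liftEw D) /D ?fsubsetUr //.
- rewrite scaler_sumr -big_split /=; apply: eq_bigr => w _.
  by rewrite mcoeffD mcoeffZ scalerDl scalerA.
- by rewrite -fsetUA fsetUCA fsubsetUl.
- by rewrite -fsetUA fsubsetUl.
Qed.
HB.instance Definition _ :=
  GRing.isLinear.Build k {malg k[{ffun 'I_m -> A}]} V *:%R free_lift
    free_lift_is_linear.

Lemma free_liftU w : free_lift << w >> = phi w.
Proof.
rewrite (@free_liftEw [fset w]%fset) ?msuppU_le // big_seq_fset1.
by rewrite mcoeffUU scale1r.
Qed.

Hypothesis phiM : multilinear phi.

Lemma free_lift_rel z : z \in submod_span (@multilinear_rel m) -> free_lift z = 0.
Proof.
have PL a x y : free_lift x = 0 -> free_lift y = 0 -> free_lift (a *: x + y) = 0.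
  by move=> x0 y0; rewrite linearP /= x0 y0 scaler0 addr0.
pose K := submodule_of (linear0 free_lift) PL.
have KE x : x \in K <-> free_lift x = 0 := submodule_ofE _ _ x.
move=> /submod_spanP zK; apply/(KE z)/zK => _ [w [i [a [x [y ->]]]]]; apply/KE.
by rewrite linearB linearP /= !free_liftU phiM subrr.
Qed.

Definition tens_lift_fun of multilinear phi := fun t : tpow m => free_lift (repr t).

Lemma tens_lift_pi z : tens_lift_fun phiM (quot_pi _ z) = free_lift z.
Proof.
apply/eqP; rewrite -subr_eq0 -linearB; apply/eqP/free_lift_rel.
by apply/quot_piP; rewrite quot_pi_reprK.
Qed.

Fact tens_lift_is_linear : linear (tens_lift_fun phiM).
Proof.
move=> a x y; rewrite -(quot_pi_reprK x) -(quot_pi_reprK y) -linearP.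
by rewrite !tens_lift_pi linearP.
Qed.
HB.instance Definition _ :=
  GRing.isLinear.Build k (tpow m) V *:%R (tens_lift_fun phiM) tens_lift_is_linear.

Definition tens_lift : {linear tpow m -> V} := tens_lift_fun phiM.

Lemma tens_liftE w : tens_lift (tens w) = phi w.
Proof. by rewrite [LHS]tens_lift_pi free_liftU. Qed.

End Lift.

Lemma tens_ind m (P : tpow m -> Prop) : P 0 ->
  (forall a w t, P t -> P (a *: tens w + t)) -> forall t, P t.
Proof.
move=> P0 PD t; rewrite -(quot_pi_reprK t) [repr t]monalgE.
rewrite linear_sum; apply: (big_rec P) => // w x _ Px.
have -> : << (repr t)@_w *g w >> = (repr t)@_w *: << w >>.
  by apply/malgP => v; rewrite mcoeffZ !mcoeffU mulrnAr mulr1.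
by rewrite linearZ; apply: PD.
Qed.

(* A map of tuples which is linear in each argument, that argument entering a
   single coordinate of the result, induces a map of tensor powers. *)
Lemma multilinear_tens m m' (F : {ffun 'I_m -> A} -> {ffun 'I_m' -> A})
    (pos : 'I_m -> 'I_m') :
  (forall w i x c, c != pos i -> F (upd w i x) c = F w c) ->
  (forall w i a x y, F (upd w i (a *: x + y)) (pos i) =
     a *: F (upd w i x) (pos i) + F (upd w i y) (pos i)) ->
  multilinear (fun w => tens (F w)).
Proof.
move=> Fout Fin w i a x y.
have FE z : F (upd w i z) = upd (F w) (pos i) (F (upd w i z) (pos i)).
  by apply/ffunP => c; rewrite ffunE; case: eqP => [->//|/eqP /Fout ->].
by rewrite [in LHS]FE Fin tens_multilinear -!FE.
Qed.

End TensorPower.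

Section Gradings.
Variables (k : comNzRingType) (A : algType k).

(* A grading of A by the integers; gradings by the natural numbers are those
   vanishing in negative degrees. *)
Record grading := Grading {
  homog :> int -> submodule A;
  homog1 : 1 \in homog 0;
  homogM : forall i j a b, a \in homog i -> b \in homog j ->
    a * b \in homog (i + j);
  homog_gen : forall a, exists (r : seq int) (f : int -> A),
    (forall i, f i \in homog i) /\ a = \sum_(i <- r) f i;
  homog_indep : forall (r : seq int) (f : int -> A), uniq r ->
    (forall i, f i \in homog i) -> \sum_(i <- r) f i = 0 ->
    forall i, i \in r -> f i = 0 }.

Definition gr_alg (G : grading) : grmod k := @GrMod k A G.

Definition gr_tpow (G : grading) (m : nat) : grmod k :=
  @GrMod k (tpow A m) (fun j => submod_span (fun t =>
    exists (w : {ffun 'I_m -> A}) (deg : 'I_m -> int),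
      [/\ forall c, w c \in G (deg c), \sum_c deg c = j & t = tens w])).

End Gradings.

Section Hochschild.
Variables (k : comNzRingType) (A : algType k).

Definition hoch_face (r : nat) (i : 'I_r.+2) (w : {ffun 'I_r.+2 -> A}) :
  {ffun 'I_r.+1 -> A} :=
  [ffun c : 'I_r.+1 =>
    let wc := w (lift ord_max c) in  (* entry number c *)
    let wSc := w (lift ord0 c) in    (* entry number c + 1 *)
    if i == ord_max then if c == ord0 then w ord_max * w ord0 else wc
    else if (c < i)%N then wc
    else if c == i :> nat then wc * wSc
    else wSc].

Lemma hoch_face_multilinear r i : multilinear (fun w => tens (@hoch_face r i w)).
Proof.
pose posn (u : nat) := if i == r.+1 :> nat then if u == r.+1 then 0%N else u
  else if (u <= i)%N then u else u.-1.
pose pos (u : 'I_r.+2) : 'I_r.+1 := inord (posn u).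
have posE u : pos u = posn u :> nat.
  rewrite inordK // /posn; have := ltn_ord u; have := ltn_ord i.
  by repeat case: ifPn; lia.
apply: (multilinear_tens (pos := pos)) => [w u x c|w u a x y].
  rewrite -val_eqE /= posE /posn !ffunE -!val_eqE /= /bump /=.
  have := ltn_ord u; have := ltn_ord i; have := ltn_ord c.
  by repeat case: ifPn => ?; try lia; move=> *.
have := posE u; move: (pos u) => p; rewrite /posn !ffunE -!val_eqE /= /bump /=.
have := ltn_ord u; have := ltn_ord i; have := ltn_ord p.
by repeat case: ifPn => ?; try lia; move=> *;
   rewrite ?(mulrDl, mulrDr) -?(scalerAl, scalerAr).
Qed.

Definition hoch_face_map (r : nat) (i : 'I_r.+2) : {linear tpow A r.+2 -> tpow A r.+1} :=
  tens_lift (@hoch_face_multilinear r i).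

(* The boundary out of C_r = A^(r+1); it is 0 on C_0, where the target
   [tpow A 0] is a dummy. *)
Definition hoch_bdry (r : nat) : tpow A r.+1 -> tpow A r :=
  match r with
  | 0 => fun _ => 0
  | r'.+1 => fun t => \sum_(i < r'.+2) (-1) ^+ i *: hoch_face_map i t
  end.

Fact hoch_bdry_is_linear r : linear (@hoch_bdry r).
Proof.
case: r => [|r] a x y /=; first by rewrite scaler0 addr0.
rewrite scaler_sumr -big_split; apply: eq_bigr => i _ /=.
by rewrite linearP scalerDr !scalerA mulrC.
Qed.
HB.instance Definition _ r :=
  GRing.isLinear.Build k (tpow A r.+1) (tpow A r) *:%R (@hoch_bdry r)
    (@hoch_bdry_is_linear r).

Definition hoch_cycles (r : nat) : submodule (tpow A r.+1).
Proof.
apply: (@submodule_of _ _ (fun x => hoch_bdry x = 0)); first exact: linear0.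
by move=> a x y x0 y0; rewrite linearP /= x0 y0 scaler0 addr0.
Defined.

Definition hoch_boundaries (r : nat) : submodule (tpow A r.+1).
Proof.
apply: (@submodule_of _ _ (fun x => exists y : tpow A r.+2, x = hoch_bdry y)).
- by exists 0; rewrite linear0.
- by move=> a _ _ [x ->] [y ->]; exists (a *: x + y); rewrite linearP.
Defined.

Definition HH (G : grading A) (r : nat) : grmod k :=
  @gr_subquot k (gr_tpow G r.+1) (hoch_cycles r) (hoch_boundaries r).

Definition gr_cocenter (G : grading A) : grmod k :=
  @gr_quot k (gr_alg G) (submod_span (fun x : A => exists a b : A, x = a * b - b * a)).

End Hochschild.

Section Polygon.
(* The vertices of P_N are v_0, ..., v_(N-1); edge number e runs from v_(e-1)
   to v_e, indices mod N, so that the edge e_N is numbered 0. *)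
Variable N : nat.

Definition src (e : 'I_N) : 'I_N := ord_pred e.
Definition tgt (e : 'I_N) : 'I_N := e.

(* Adjacency in [P_N : s], disregarding orientation. *)
Definition adj (s : {set 'I_N}) : rel 'I_N := fun u v =>
  [exists e in s, ((src e == u) && (tgt e == v)) || ((src e == v) && (tgt e == u))].

(* The components of [P_N : s] are arcs, so their cyclic order starting from the
   component of v_0 is the order of their least vertices. *)
Definition least_in_comp (s : {set 'I_N}) (v : 'I_N) : bool :=
  [forall w, connect (adj s) v w ==> (v <= w)%N].

Definition least_seq (s : {set 'I_N}) : seq 'I_N :=
  [seq v <- enum 'I_N | least_in_comp s v].

Lemma adj_sym s : connect_sym (adj s).
Proof.
by apply: sym_connect_sym => u v; apply: eq_existsb => e; rewrite orbC.
Qed.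

Lemma exists_least s v : exists2 u, connect (adj s) v u & least_in_comp s u.
Proof.
case: (arg_minnP (P := connect (adj s) v) (fun w : 'I_N => w : nat) (connect0 _ v)).
move=> u vu umin; exists u => //; apply/forallP => w; apply/implyP => uw.
exact/umin/(connect_trans vu).
Qed.

Lemma least_uniq s u v : least_in_comp s u -> least_in_comp s v ->
  connect (adj s) u v -> u = v.
Proof.
move=> /forallP /(_ v) /implyP ul /forallP /(_ u) /implyP vl uv.
by apply/val_inj/eqP; rewrite eqn_leq ul // vl // adj_sym.
Qed.

Lemma size_least_seq s : size (least_seq s) == n_comp (adj s) predT.
Proof.
have Lu : uniq (least_seq s) by apply/filter_uniq/enum_uniq.
rewrite /n_comp_mem -(size_map (fingraph.root (adj s))) -(card_uniqP _); last first.
  rewrite map_inj_in_uniq // => u v.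
  rewrite !mem_filter => /andP[ul _] /andP[vl _] /eqP.
  by rewrite root_connect; [exact: least_uniq | exact: adj_sym].
apply/eqP/eq_card => r; apply/mapP/idP => [[u _ ->]|].
  by rewrite !inE roots_root //; apply: adj_sym.
rewrite !inE andbT => /eqP rr; have [u ru ul] := exists_least s r.
exists u; first by rewrite mem_filter ul mem_enum.
by rewrite -[LHS]rr; apply/eqP; rewrite root_connect //; apply: adj_sym.
Qed.

End Polygon.

(* The definitions below are locked because the comparison of two instances of
   them would unfold to graph searches. *)
HB.lock Definition ncomp (N : nat) (s : {set 'I_N}) : nat := n_comp (adj s) predT.

Lemma size_least_seq_ncomp N (s : {set 'I_N}) : size (least_seq s) == ncomp s.
Proof. by rewrite ncomp.unlock size_least_seq. Qed.

(* The least vertex of component number c. *)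
HB.lock Definition comp_vertex (N : nat) (s : {set 'I_N}) (c : 'I_(ncomp s)) : 'I_N :=
  tnth (Tuple (size_least_seq_ncomp s)) c.

Lemma exists_comp N (s : {set 'I_N}) v :
  exists c : 'I_(ncomp s), connect (adj s) v (comp_vertex c).
Proof.
have [u vu ul] := exists_least s v.
have : u \in Tuple (size_least_seq_ncomp s) by rewrite mem_filter ul mem_enum.
by move=> /tnthP[c uE]; exists c; rewrite comp_vertex.unlock -uE.
Qed.

(* The number of the component containing v. *)
HB.lock Definition comp_of (N : nat) (s : {set 'I_N}) (v : 'I_N) : 'I_(ncomp s) :=
  xchoose (exists_comp s v).

Section PolygonComplex.
Variable N : nat.
Implicit Types (s : {set 'I_N}) (e : 'I_N).

Lemma comp_ofP s v : connect (adj s) v (comp_vertex (comp_of s v)).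
Proof. by rewrite comp_of.unlock; apply: xchooseP (exists_comp s v). Qed.

Lemma comp_vertex_least s (c : 'I_(ncomp s)) : least_in_comp s (comp_vertex c).
Proof.
have := mem_tnth c (Tuple (size_least_seq_ncomp s)).
by rewrite comp_vertex.unlock mem_filter => /andP[].
Qed.

Lemma comp_vertex_inj s : injective (@comp_vertex N s).
Proof.
have u : uniq (Tuple (size_least_seq_ncomp s)) by apply/filter_uniq/enum_uniq.
by rewrite comp_vertex.unlock; apply/tuple_uniqP.
Qed.

Lemma comp_of_eq s u v : (comp_of s u == comp_of s v) = connect (adj s) u v.
Proof.
have sym := adj_sym s; apply/eqP/idP => [uv|uv].
  by apply: connect_trans (comp_ofP s u) _; rewrite uv sym comp_ofP.
apply/comp_vertex_inj/(@least_uniq N s); rewrite ?comp_vertex_least //.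
apply: connect_trans (comp_ofP s v); apply: connect_trans uv.
by rewrite sym comp_ofP.
Qed.

Lemma comp_vertexK s c : comp_of s (comp_vertex c) = c.
Proof.
apply/comp_vertex_inj/(@least_uniq N s); rewrite ?comp_vertex_least //.
by rewrite adj_sym comp_ofP.
Qed.

Lemma adj_edge s e : e \in s -> adj s (src e) (tgt e).
Proof. by move=> es; apply/existsP; exists e; rewrite es !eqxx. Qed.

Lemma sub_connect s e u v : connect (adj s) u v -> connect (adj (e |: s)) u v.
Proof.
apply: connect_sub => x y /existsP[f /andP[fs H]]; apply: connect1.
by apply/existsP; exists f; rewrite in_setU1 fs orbT.
Qed.

Lemma connect_setU1 s e u v : connect (adj (e |: s)) u v ->
  connect (adj s) u v ||
  (connect (adj s) u (src e) || connect (adj s) u (tgt e)) &&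
  (connect (adj s) v (src e) || connect (adj s) v (tgt e)).
Proof.
move=> /connectP[p pP ->] /=; elim: p u pP => [|x p IH] u /=.
  by rewrite connect0.
move=> /andP[/existsP[f /andP[fs ux]] /IH]; rewrite in_setU1 in fs.
have [fe|fe] := eqVneq f e.
  rewrite fe in ux; case/orP: ux => /andP[/eqP <- /eqP <-];
  by case/orP => [xl|/andP[_ ->]]; first (rewrite adj_sym in xl; rewrite xl);
     rewrite connect0 !orbT.
have {}ux : connect (adj s) u x.
  by rewrite connect1 //; apply/existsP; exists f; rewrite (negPf fe) /= in fs; rewrite fs.
by rewrite !(same_connect (adj_sym s) ux).
Qed.

Definition same_comp (s : {set 'I_N}) (e : 'I_N) : bool :=
  comp_of s (src e) == comp_of s (tgt e).

Section Weights.
Variables (k : comNzRingType) (A : algType k).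

(* The effect on weights of adding e to s: the components containing the ends
   of e are merged if they differ, and all other weights are kept. *)
Definition merge s e (w : {ffun 'I_(ncomp s) -> A}) :
  {ffun 'I_(ncomp (e |: s)) -> A} :=
  [ffun c => if ~~ same_comp s e && (c == comp_of (e |: s) (src e))
             then w (comp_of s (src e)) * w (comp_of s (tgt e))
             else w (comp_of s (comp_vertex c))].

Lemma mergeE s e (w : {ffun 'I_(ncomp s) -> A}) c : merge e w c =
  if ~~ same_comp s e && (c == comp_of (e |: s) (src e))
  then w (comp_of s (src e)) * w (comp_of s (tgt e))
  else w (comp_of s (comp_vertex c)).
Proof. exact: ffunE. Qed.

Lemma merge_same s e (w : {ffun 'I_(ncomp s) -> A}) v :
  same_comp s e -> merge e w (comp_of (e |: s) v) = w (comp_of s v).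
Proof.
move=> st; rewrite mergeE st /=; congr (w _).
have: connect (adj (e |: s)) (comp_vertex (comp_of (e |: s) v)) v.
  by rewrite adj_sym comp_ofP.
move=> /connect_setU1; rewrite -!comp_of_eq (eqP st) !orbb.
by case/orP => [/eqP|/andP[/eqP -> /eqP]].
Qed.

Lemma merge_multilinear s e : multilinear (fun w => tens (@merge s e w)).
Proof.
pose pos (i : 'I_(ncomp s)) := comp_of (e |: s) (comp_vertex i).
have posE v : pos (comp_of s v) = comp_of (e |: s) v.
  by apply/eqP; rewrite comp_of_eq adj_sym sub_connect // comp_ofP.
have updE (w : {ffun 'I_(ncomp s) -> A}) i z c :
  upd w i z c = if c == i then z else w c by exact: ffunE.
have stE : comp_of (e |: s) (src e) = comp_of (e |: s) (tgt e).
  by apply/eqP; rewrite comp_of_eq connect1 // adj_edge // setU11.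
apply: (multilinear_tens (pos := pos)) => [w i x c ci|w i a x y].
  have ne v : comp_of (e |: s) v = c -> (comp_of s v == i) = false.
    by move=> vc; apply: contraNF ci => /eqP <-; rewrite posE vc.
  rewrite !mergeE !updE; case: ifP => [/andP[_ /eqP cE]|_].
    by rewrite !ne // -stE.
  by rewrite ne // comp_vertexK.
rewrite !mergeE !updE; case: ifP => [/andP[]|ne].
  rewrite /same_comp => st /eqP iE.
  have: connect (adj (e |: s)) (comp_vertex i) (src e).
    by rewrite -comp_of_eq; apply/eqP.
  move=> /connect_setU1; rewrite -!comp_of_eq comp_vertexK.
  rewrite eqxx /= andbT orbA orbb => /orP[] /eqP ->; rewrite eqxx.
    by rewrite eq_sym (negPf st) mulrDl scalerAl.
  by rewrite (negPf st) mulrDr scalerAr.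
suff -> : comp_of s (comp_vertex (pos i)) = i by rewrite eqxx.
have: connect (adj (e |: s)) (comp_vertex (pos i)) (comp_vertex i).
  by rewrite -comp_of_eq comp_vertexK.
move=> /connect_setU1; rewrite -!comp_of_eq !comp_vertexK.
case/orP => [/eqP //|/andP[Hp Hi]].
have [|st] := boolP (same_comp s e).
  by move=> /eqP st; move: Hp Hi; rewrite st !orbb => /eqP -> /eqP.
have pi_end : pos i == comp_of (e |: s) (src e).
  by case/orP: Hi => /eqP ->; rewrite posE // stE.
by rewrite st pi_end in ne.
Qed.

Definition states s : lmodType k := tpow A (ncomp s).

Definition edge_map s e : {linear states s -> states (e |: s)} :=
  tens_lift (@merge_multilinear s e).

(* The map for s ⊂ s ∪ e. When both ends of e lie in the same component of
   [P_N : s] it is zero for the hatted theory and, for the other one, the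
   identity (see [merge_same]). *)
Definition edge_map_hat s e : {linear states s -> states (e |: s)} :=
  if same_comp s e then (\0 : {linear _ -> _}) else edge_map s e.

Definition cochains : lmodType k := direct_sum states.

Definition gr_cochains (G : grading A) : grmod k.
Proof.
refine (@GrMod k cochains (fun j => @submodule_of _ _ (fun x : cochains =>
  forall s, ds_coord s x \in gr_deg (gr_tpow G (ncomp s)) j) _ _)).
- by move=> s; rewrite linear0 rpred0.
- by move=> a x y Dx Dy s; rewrite linearP rpredD ?rpredZ ?Dx ?Dy.
Defined.

(* C^i, as a submodule of the direct sum over all sets of edges. *)
Definition cochains_in (i : nat) : submodule cochains.
Proof.
apply: (@submodule_of _ _ (fun x : cochains =>
  forall s, #|s| != i -> ds_coord s x = 0)).
- by move=> s _; rewrite linear0.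
- by move=> a x y Cx Cy s si; rewrite linearP /= Cx // Cy // scaler0 addr0.
Defined.

Section Cohomology.
Variable leE : rel 'I_N.
Variable Phi : forall s e, {linear states s -> states (e |: s)}.

Definition nsmaller s e : nat := #|[set f in s | (f != e) && leE f e]|.

Definition codiff (x : cochains) : cochains :=
  \sum_(s : {set 'I_N}) \sum_(e | e \notin s)
    (-1) ^+ nsmaller s e *: @ds_inj k _ states (e |: s) (Phi s e (ds_coord s x)).

Fact codiff_is_linear : linear codiff.
Proof.
move=> a x y; rewrite scaler_sumr -big_split; apply: eq_bigr => s _ /=.
rewrite scaler_sumr -big_split; apply: eq_bigr => e _ /=.
by rewrite [ds_coord _ _]linearP [Phi _ _ _]linearP linearP scalerDr !scalerA mulrC.
Qed.
HB.instance Definition _ :=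
  GRing.isLinear.Build k cochains cochains *:%R codiff codiff_is_linear.

Definition cocycles (i : nat) : submodule cochains.
Proof.
apply: (@submodule_of _ _ (fun x => x \in cochains_in i /\ codiff x = 0)).
- by rewrite rpred0 linear0.
- move=> a x y [Cx x0] [Cy y0]; rewrite rpredD ?rpredZ //.
  by rewrite linearP /= x0 y0 scaler0 addr0.
Defined.

(* d(C^(i-1)), where C^(-1) = 0. *)
Definition coboundaries (i : nat) : submodule cochains.
Proof.
apply: (@submodule_of _ _ (fun x => exists2 y : cochains,
  (forall s, #|s|.+1 != i -> ds_coord s y = 0) & x = codiff y)).
- by exists 0 => [s _|]; rewrite linear0.
- move=> a _ _ [x Cx ->] [y Cy ->]; exists (a *: x + y); last by rewrite linearP.
  by move=> s si; rewrite linearP /= Cx // Cy // scaler0 addr0.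
Defined.

Definition cohomology (G : grading A) (i : nat) : grmod k :=
  @gr_subquot k (gr_cochains G) (cocycles i) (coboundaries i).

End Cohomology.

End Weights.
End PolygonComplex.

Definition graph_cohomology_hat (k : comNzRingType) (A : algType k) (G : grading A) (N : nat)
  (leE : rel 'I_N) (i : nat) : grmod k := cohomology leE (@edge_map_hat N k A) G i.

(* Meant for commutative A only; otherwise the square of d need not vanish. *)
Definition graph_cohomology (k : comNzRingType) (A : algType k) (G : grading A) (N : nat)
  (leE : rel 'I_N) (i : nat) : grmod k := cohomology leE (@edge_map N k A) G i.

(* Main.v *)
From HB Require Import structures.
Require Import Defs.
From mathcomp Require Import all_boot all_order all_algebra.
From mathcomp Require Import boolp zify.

Set Implicit Arguments.
Unset Strict Implicit.
Unset Printing Implicit Defensive.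

Import GRing.Theory.
Local Open Scope ring_scope.

(** Describe a set of edges by the set [u] of initial vertices of the missing
    edges, and let X be the cyclic bar construction, X_r = A^(r+1). If [u] has
    r + 1 > 0 elements, the states form X_r, and adding an edge is a face map
    of X. So, up to signs, the hatted complex consists of the chains on the faces
    [u] of an n-simplex, a face of dimension r having coefficients in X_r, with
    boundary the alternating sum of (u; x) |-> (u minus its j-th vertex; d_j x).
    Forgetting [u] is a chain map to the Hochschild complex, and it induces an
    isomorphism in homology in degrees r < n. Indeed, degeneracies show that the
    chains on the faces containing the vertices q, ..., m are acyclic, so every
    cycle is homologous to one carried by the single face {0, ..., r}; its value
    is killed by all d_i. By Moore's normalization theorem such elements, modulo
    the d_(r+1) y with all other d_i y zero, compute Hochschild homology.
    The other theory differs from the hatted one only in its last differential,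
    whose kernel consists of the chains that become 0 when [u] is forgotten; they
    are boundaries by the injectivity above. *)

(** * Simplicial modules with coefficients on a simplex *)

(* [simplicial_obj m] is the module of (m - 1)-simplices; [simplicial_obj 0] is a dummy.
   Faces and degeneracies with an index out of range are required to make the
   simplicial identities hold, hence should be 0. *)
Record simplicial_module (k : comNzRingType) := SimplicialModule {
  simplicial_obj :> nat -> lmodType k;
  face : forall m, nat -> {linear simplicial_obj m.+1 -> simplicial_obj m};
  degen : forall m, nat -> {linear simplicial_obj m -> simplicial_obj m.+1};
  face_out : forall m i x, (m < i)%N -> face m i x = 0;
  face_face : forall m i j x, (i < j)%N ->
    face m i (face m.+1 j x) = face m j.-1 (face m.+1 i x);
  face_degen_lt : forall m i j x, (i < j)%N ->
    face m.+1 i (degen m.+1 j x) = degen m j.-1 (face m i x);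
  face_degen_id : forall m j x, (j <= m)%N -> face m.+1 j (degen m.+1 j x) = x;
  face_degen_idS : forall m j x, (j <= m)%N -> face m.+1 j.+1 (degen m.+1 j x) = x;
  face_degen_gt : forall m i j x, (j.+1 < i)%N ->
    face m.+1 i (degen m.+1 j x) = degen m j (face m i.-1 x) }.

(** * Positions of vertices in a face *)

Section Rank.
Variable N : nat.
Implicit Types (u v : {set 'I_N}) (g h : 'I_N).

Definition rank u (x : nat) : nat := \sum_(h in u) (h < x)%N.

Lemma leq_rank u x y : (x <= y)%N -> (rank u x <= rank u y)%N.
Proof. by move=> xy; apply: leq_sum => h _; lia. Qed.

Lemma rank_setU1 u g x : g \notin u -> rank (g |: u) x = ((g < x) + rank u x)%N.
Proof. by move=> gu; rewrite /rank big_setU1. Qed.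

Lemma rank_card u x : (rank u x <= #|u|)%N.
Proof.
by rewrite -sum1_card; apply: leq_sum => h _; case: (h < x)%N.
Qed.

Lemma rank_all u x : (forall g, g \in u -> (g < x)%N) -> rank u x = #|u|.
Proof. by move=> ux; rewrite -sum1_card; apply: eq_bigr => h /ux ->. Qed.

Lemma rankS_in u g : g \in u -> rank u g.+1 = (rank u g).+1.
Proof.
move=> gu; rewrite /rank !(bigD1 (P := mem u) g gu) /= ltnSn ltnn add1n add0n.
congr _.+1; apply: eq_bigr => h /andP[_ hg].
by rewrite ltnS ltn_neqAle; move: hg; rewrite -val_eqE /= => ->.
Qed.

Lemma rankS_notin u g : g \notin u -> rank u g.+1 = rank u g.
Proof.
move=> gu; apply: eq_bigr => h hu; rewrite ltnS leq_eqVlt.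
by case: eqP => // /val_inj hg; rewrite -hg hu in gu.
Qed.

Lemma rank_initial u x : (x <= N)%N -> (forall g, (g < x)%N -> g \in u) ->
  rank u x = x.
Proof.
elim: x => [|x IH] xN ux; first exact: big1.
have /= -> := rankS_in (ux (Ordinal xN) (ltnSn x)); rewrite IH ?(ltnW xN) //.
by move=> g gx; rewrite ux // leqW.
Qed.

Lemma rank_lt u g h : g \in u -> (g < h)%N -> (rank u g < rank u h)%N.
Proof. by move=> gu gh; rewrite -rankS_in // leq_rank. Qed.

Lemma rank_lt_card u g : g \in u -> (rank u g < #|u|)%N.
Proof. by move=> gu; rewrite -rankS_in // rank_card. Qed.

Lemma rank_inj u : {in u &, injective (fun g : 'I_N => rank u g)}.
Proof.
move=> g h gu hu /= gh; apply/val_inj.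
case: (ltngtP g h) => // lt; [have := rank_lt gu lt | have := rank_lt hu lt].
  by rewrite gh ltnn.
by rewrite gh ltnn.
Qed.

(** The ranks are distinct and below [#|u|], and there are [#|u|] of them, so none is missed. *)
Lemma perm_rank u : perm_eq [seq rank u (g : 'I_N) | g <- enum u] (iota 0 #|u|).
Proof.
have uu : uniq [seq rank u (g : 'I_N) | g <- enum u].
  rewrite map_inj_in_uniq ?enum_uniq // => g h; rewrite !mem_enum.
  exact: rank_inj.
apply: uniq_perm; rewrite ?iota_uniq //.
apply: (uniq_min_size uu _ _).2; last by rewrite size_iota size_map -cardE.
move=> x /mapP[g]; rewrite mem_enum mem_iota add0n => gu ->.
exact: rank_lt_card.
Qed.

Lemma rank_onto u j : (j < #|u|)%N -> exists2 g, g \in u & rank u g = j.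
Proof.
move=> ju; have : j \in [seq rank u (g : 'I_N) | g <- enum u].
  by rewrite (perm_mem (perm_rank u)) mem_iota.
by case/mapP => g; rewrite mem_enum => gu ->; exists g.
Qed.

Lemma sum_rank (V : nmodType) u (f : nat -> V) :
  \sum_(g in u) f (rank u g) = \sum_(i < #|u|) f i.
Proof.
rewrite -(big_mkord xpredT f) /index_iota subn0 -(perm_big _ (perm_rank u)).
by rewrite big_map big_enum.
Qed.

End Rank.

(** * Boundaries, with and without the underlying face *)

Section Boundary.
Variables (k : comNzRingType) (Y : simplicial_module k).

Definition bdry m (x : Y m.+1) : Y m := \sum_(i < m.+1) (-1) ^+ i *: face Y m i x.

Fact bdry_is_linear m : linear (@bdry m).
Proof.
move=> a x y; rewrite scaler_sumr -big_split; apply: eq_bigr => i _ /=.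
by rewrite linearP scalerDr !scalerA mulrC.
Qed.
HB.instance Definition _ m :=
  GRing.isLinear.Build k (Y m.+1) (Y m) *:%R (@bdry m) (@bdry_is_linear m).

Section SimplexChains.
Variable N : nat.
Implicit Types (u v : {set 'I_N}).

(* A chain gives to a face [u] of the simplex on ['I_N] a coefficient in [Y #|u|]. *)
Definition sbdry m (z : {set 'I_N} -> Y m.+1) u : Y m :=
  \sum_(g | g \notin u) (-1) ^+ rank u g *: face Y m (rank u g) (z (g |: u)).

Definition supported m (P : {set 'I_N} -> Prop) (z : {set 'I_N} -> Y m) :=
  forall u, ~ P u -> z u = 0.

Lemma sbdryB m (z1 z2 : {set 'I_N} -> Y m.+1) u :
  sbdry (fun v => z1 v - z2 v) u = sbdry z1 u - sbdry z2 u.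
Proof.
rewrite -sumrB; apply: eq_bigr => g _.
by rewrite linearB scalerBr.
Qed.

Lemma sbdryD m (z1 z2 : {set 'I_N} -> Y m.+1) u :
  sbdry (fun v => z1 v + z2 v) u = sbdry z1 u + sbdry z2 u.
Proof.
rewrite -big_split; apply: eq_bigr => g _ /=.
by rewrite linearD scalerDr.
Qed.

Lemma eq_sbdry m (z1 z2 : {set 'I_N} -> Y m.+1) u :
  (forall g, g \notin u -> z1 (g |: u) = z2 (g |: u)) -> sbdry z1 u = sbdry z2 u.
Proof. by move=> e; apply: eq_bigr => g gu; rewrite e. Qed.

(** The ordered pairs of inserted vertices are split by which one is smaller, and swapping the two
    matches the halves. Inserting the smaller vertex raises the rank of the larger by one, so
    matched terms agree by [face_face] and have opposite signs. *)
Lemma sbdry_sbdry m (z : {set 'I_N} -> Y m.+2) u : sbdry (sbdry z) u = 0.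
Proof.
pose T (g h : 'I_N) := (-1) ^+ rank u g *: face Y m (rank u g)
  ((-1) ^+ rank (g |: u) h *: face Y m.+1 (rank (g |: u) h) (z (h |: (g |: u)))).
pose P (g h : 'I_N) := (g \notin u) && (h \notin u).
have -> : sbdry (sbdry z) u =
  \sum_g \sum_(h | P g h && (g < h)%N) T g h + \sum_g \sum_(h | P g h && (h < g)%N) T g h.
  rewrite -big_split /= /sbdry big_mkcond; apply: eq_bigr => g _.
  rewrite /P; case: (boolP (g \in u)) => gu /=; first by rewrite !big_pred0_eq addr0.
  rewrite linear_sum scaler_sumr /=.
  rewrite (bigID (fun h : 'I_N => (g < h)%N)) /=.
  congr (_ + _); apply: eq_bigl => h; rewrite !inE negb_or -val_eqE /=;
    by case: (ltngtP g h); rewrite ?andbF ?andbT.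
rewrite [X in _ + X](exchange_big_dep xpredT) //= -big_split /= big1 // => g _.
rewrite [X in _ + X](eq_bigl (fun h => P g h && (g < h)%N)); last first.
  by move=> h; rewrite /P [_ && (h \notin u)]andbC.
rewrite -big_split /= big1 // => h /andP[/andP[gu hu] gh].
have le : (rank u g <= rank u h)%N by rewrite leq_rank // ltnW.
rewrite /T !rank_setU1 // gh ltnNge (ltnW gh) /= add1n add0n.
rewrite !linearZ /= !scalerA -!exprD face_face //.
by rewrite setUCA addSn exprS mulN1r scaleNr addnC addNr.
Qed.

Definition chain_sum m (z : {set 'I_N} -> Y m) : Y m := \sum_u z u.

(** The faces of the coefficient on [v] are indexed by the vertices of [v] instead of their ranks;
    both sides then run over the same pairs, through [v = g |: u]. *)
Lemma chain_sum_sbdry m (z : {set 'I_N} -> Y m.+1) :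
  supported (fun u => #|u| = m.+1) z -> chain_sum (sbdry z) = bdry (chain_sum z).
Proof.
move=> zs; rewrite /chain_sum /bdry.
under [RHS]eq_bigr => i _ do rewrite linear_sum scaler_sumr.
rewrite [RHS]exchange_big /=.
have E v : \sum_(i < m.+1) (-1) ^+ i *: face Y m i (z v) =
    \sum_(g in v) (-1) ^+ rank (v :\ g) g *: face Y m (rank (v :\ g) g) (z v).
  have [vm|/eqP vm] := eqVneq #|v| m.+1; last first.
    by rewrite zs // !big1 // => *; rewrite linear0 scaler0.
  have := sum_rank v (fun i => (-1) ^+ i *: face Y m i (z v)); rewrite vm => <-.
  apply: eq_bigr => g gv; congr (_ ^+ _ *: face Y m _ _);
  by rewrite -[in LHS](setD1K gv) rank_setU1 ?setD11 // ltnn.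
under [RHS]eq_bigr => v _ do rewrite E.
rewrite (exchange_big_dep xpredT) //= [RHS](exchange_big_dep xpredT) //=.
apply: eq_bigr => g _.
rewrite [RHS](reindex_onto (fun u => g |: u) (fun v => v :\ g)) /=; last first.
  by move=> v gv; rewrite setD1K.
apply: eq_big => [u|u gu]; last by rewrite setU1K.
rewrite setU11 /=; apply/idP/eqP => [gu|<-]; first by rewrite setU1K.
by rewrite setD11.
Qed.

End SimplexChains.

(** Follows from [sbdry_sbdry] by placing [x] on the top face of a simplex with m + 2 vertices and
    forgetting the faces. *)
Lemma bdry_bdry m (x : Y m.+2) : bdry (bdry x) = 0.
Proof.
pose z (v : {set 'I_m.+2}) : Y m.+2 := if v == setT then x else 0.
have zs : supported (fun v => #|v| = m.+2) z.
  by move=> v; rewrite /z; case: eqP => // -> []; rewrite cardsT card_ord.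
have zt : chain_sum z = x.
  rewrite /chain_sum (bigD1 setT) //= {1}/z eqxx big1 ?addr0 // => v /negPf vT.
  by rewrite /z vT.
have dzs : supported (fun v => #|v| = m.+1) (sbdry z).
  move=> v vm; rewrite /sbdry big1 // => g gv; rewrite zs ?linear0 ?scaler0 //.
  by rewrite cardsU1 gv add1n => -[].
rewrite -zt -chain_sum_sbdry // -chain_sum_sbdry // /chain_sum big1 // => v _.
exact: sbdry_sbdry.
Qed.

End Boundary.

(** * Moore normalization *)

Section Moore.
Variables (k : comNzRingType) (Y : simplicial_module k).

(** Faces p and p + 1 of the degenerate element cancel each other. The higher ones cancel against
    [degen Y m p (bdry x)], shifted by one, except for the term of face p. *)
Lemma bdry_degen m p (x : Y m.+1) : (p <= m)%N ->
  (forall i, (i < p)%N -> face Y m i x = 0) ->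
  bdry (degen Y m.+1 p x) + degen Y m p (bdry x) =
    (-1) ^+ p *: degen Y m p (face Y m p x).
Proof.
move=> pm x0; rewrite /bdry linear_sum /=.
rewrite -(big_mkord xpredT (fun i => (-1) ^+ i *: face Y m.+1 i (degen Y m.+1 p x))).
rewrite -(big_mkord xpredT (fun i => degen Y m p ((-1) ^+ i *: face Y m i x))).
rewrite (big_cat_nat (n := p)) //= ?(leq_trans pm) ?leqW // big_nat big1 ?add0r; last first.
  by move=> i ip; rewrite face_degen_lt // x0 // linear0 scaler0.
rewrite [X in _ + X](big_cat_nat (n := p)) //= ?leqW // [X in _ + (X + _)]big_nat.
rewrite [X in _ + (X + _)]big1 ?add0r; last first.
  by move=> i ip; rewrite x0 // scaler0 linear0.
rewrite big_ltn 1?ltnW // big_ltn // [X in _ + X]big_ltn //.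
rewrite face_degen_id // face_degen_idS // exprS mulN1r scaleNr addrA addrN add0r.
rewrite big_add1 /= addrCA linearZ /= -big_split /= big_nat big1 ?addr0 // => i /andP[pi _].
by rewrite face_degen_gt // linearZ /= exprS mulN1r scaleNr addNr.
Qed.

(** Applies 1 - s_i d_i for i = 0, ..., p - 1 in this order; each factor kills one more face and
    keeps the earlier ones zero. *)
Fixpoint moore m p (x : Y m.+1) : Y m.+1 :=
  if p is p'.+1 then let y := moore p' x in y - degen Y m p' (face Y m p' y) else x.

Lemma moore_face m p (x : Y m.+1) i : (p <= m)%N -> (i < p)%N ->
  face Y m i (moore p x) = 0.
Proof.
case: m x => [|m] x; first by case: p.
elim: p i => // p IH i pm; rewrite ltnS leq_eqVlt linearB /= => /orP[/eqP ->|ip].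
  by rewrite face_degen_id // subrr.
by rewrite face_degen_lt // face_face // (IH i (ltnW pm) ip) !linear0 addr0.
Qed.

(** On a cycle, [bdry_degen] exhibits each correction term as a boundary, up to sign. *)
Lemma moore_homologous m p (x : Y m.+1) : (p <= m)%N -> bdry x = 0 ->
  exists y, moore p x = x - bdry y.
Proof.
elim: p => [|p IH] pm x0 /=; first by exists 0; rewrite linear0 subr0.
have [y e] := IH (ltnW pm) x0.
have b0 : bdry (moore p x) = 0 by rewrite e linearB /= bdry_bdry x0 subrr.
have := bdry_degen (ltnW pm) (fun i => moore_face x (ltnW pm) (i := i)).
rewrite b0 linear0 addr0 => /(congr1 (fun z => (-1) ^+ p *: z)).
rewrite scalerA -expr2 sqrr_sign scale1r => <-.
exists (y + (-1) ^+ p *: degen Y m.+1 p (moore p x)).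
by rewrite {1}e [in RHS]linearD [in RHS]linearZ /= opprD addrA.
Qed.

(** Normalization kills all faces but the last, which is then, up to sign, the whole boundary of a
    cycle. *)
Lemma moore_cycle m (x : Y m.+1) i : bdry x = 0 -> face Y m i (moore m x) = 0.
Proof.
move=> x0; case: (ltngtP i m) => im; first exact: moore_face.
  exact: face_out.
have [y e] := moore_homologous (leqnn m) x0.
have : bdry (moore m x) = 0 by rewrite e linearB /= bdry_bdry x0 subrr.
rewrite /bdry big_ord_recr /= big1 ?add0r => [|j _]; last first.
  by rewrite moore_face ?scaler0.
move=> /(congr1 (fun z => (-1) ^+ m *: z)); rewrite scalerA -expr2 sqrr_sign.
by rewrite scale1r scaler0 im.
Qed.

(** By [bdry_degen] a correction term is, up to sign, a boundary plus a degeneracy of [x]; the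
    latter is a cycle because all faces of [x] vanish. So normalizing [y] does not change its
    boundary. *)
Lemma moore_bdry m p (x : Y m.+1) (y : Y m.+2) : (forall i, face Y m i x = 0) ->
  bdry y = x -> (p <= m.+1)%N -> bdry (moore p y) = x.
Proof.
move=> x0 yx; elim: p => // p IH pm /=; rewrite linearB /= (IH (ltnW pm)).
have sx : bdry (degen Y m.+1 p x) = 0.
  have := bdry_degen (p := p) (m := m) pm (fun i _ => x0 i); rewrite x0 linear0 scaler0.
  rewrite [bdry x]big1 ?linear0 ?addr0 // => i _; by rewrite x0 scaler0.
have := bdry_degen (ltnW pm) (fun i => moore_face y (ltnW pm) (i := i)).
rewrite (IH (ltnW pm)) => /(congr1 (fun z => (-1) ^+ p *: bdry z)).
rewrite linearD /= bdry_bdry sx addr0 scaler0 linearZ /= scalerA -expr2 sqrr_sign.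
by rewrite scale1r => <-; rewrite subr0.
Qed.

Lemma moore_closed m p (x : Y m.+1) (D : forall m, submodule (Y m)) :
  (forall m i x, x \in D m.+1 -> face Y m i x \in D m) ->
  (forall m i x, x \in D m -> degen Y m i x \in D m.+1) ->
  x \in D m.+1 -> moore p x \in D m.+1.
Proof.
move=> Df Ds Dx; elim: p => //= p IH.
by rewrite rpredB // Ds // Df.
Qed.

End Moore.

(** * Acyclicity of the chains on faces containing a block of vertices *)

Section Collapse.
Variables (k : comNzRingType) (Y : simplicial_module k) (N : nat).
Implicit Types (u v : {set 'I_N}).

(** For [q = m] these are the faces of {0, ..., m} with vertex m; for [q = 0] only the whole of {0,
    ..., m} is left. *)
Definition collar r q m u : Prop :=
  [/\ #|u| = r, forall g : 'I_N, g \in u -> (g <= m)%N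
   & forall g : 'I_N, (q <= g <= m)%N -> g \in u].

Definition restr r (P : {set 'I_N} -> Prop) (z : {set 'I_N} -> Y r) u : Y r :=
  if `[< P u >] then z u else 0.

Lemma restr_in r P (z : {set 'I_N} -> Y r) u : P u -> restr P z u = z u.
Proof. by rewrite /restr => Pu; case: asboolP. Qed.

Lemma collar_setU1 r q m u (g : 'I_N) : g \notin u -> (g <= m)%N ->
  collar r q m u -> collar r.+1 q m (g |: u).
Proof.
move=> gu gm [ur um uq]; split; first by rewrite cardsU1 gu ur.
  by move=> h; rewrite in_setU1 => /orP[/eqP ->|/um].
by move=> h /uq hu; rewrite in_setU1 hu orbT.
Qed.

(* Induction on [q]: the part of [z] on sets containing [q - 1] is a boundary by
   the induction hypothesis, and a degeneracy inserts [q - 1] in the other sets. *)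
Lemma collar_acyclic r q m (z : {set 'I_N} -> Y r.+1) :
  (m < N)%N -> (q <= m)%N -> (r < m)%N -> supported (collar r.+1 q m) z ->
  (forall u, collar r q m u -> sbdry z u = 0) ->
  exists2 y : {set 'I_N} -> Y r.+2, supported (collar r.+2 q m) y
    & forall u, collar r.+1 q m u -> sbdry y u = z u.
Proof.
move=> mN; elim: q z => [|q IH] z qm rm zs z0.
  (* For [q = 0] the set would contain all m + 1 vertices, but it has only r + 1 of them: the
     condition is empty. *)
  exists (fun=> 0) => // u [ur _ uall]; exfalso.
  by have := rank_card u m.+1; rewrite ur rank_initial // ltnS leqNgt rm.
pose qo : 'I_N := Ordinal (leq_trans qm (ltnW mN)).
have collarS j u : collar j q m u <-> collar j q.+1 m u /\ qo \in u.
  split=> [[uj um uq]|[[uj um uq] qu]]; split=> //.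
  - by split=> // g /andP[qg gm]; apply: uq; rewrite gm ltnW.
  - by apply: uq; rewrite leqnn ltnW.
  move=> g /andP[]; rewrite leq_eqVlt => /orP[/eqP e _|qg gm]; last by rewrite uq ?qg.
  by rewrite (_ : g = qo) //; apply/val_inj.
pose z' := restr (fun u => qo \in u) z.
have [|u /collarS [uc qu]|y' y's y'z] := IH z' (ltnW qm) rm.
- move=> u nc; rewrite /z' /restr; case: asboolP => // qu; apply: zs => uc.
  by apply/nc/collarS.
- rewrite -[RHS](z0 _ uc); apply: eq_sbdry => g _; apply: restr_in.
  by rewrite in_setU1 qu orbT.
(* What is left of [z] after this correction lives on sets that avoid [qo]. *)
pose z1 := restr (collar r.+1 q.+1 m) (fun u => z u - sbdry y' u).
have z1s u : ~ (collar r.+1 q.+1 m u /\ qo \notin u) -> z1 u = 0.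
  move=> nP; rewrite /z1 /restr; case: asboolP => // uc.
  have qu : qo \in u by apply/negPn/negP => qu; apply: nP.
  by rewrite y'z ?subrr; [rewrite /z' restr_in ?subrr | apply/collarS].
have z10 u : collar r q.+1 m u -> sbdry z1 u = 0.
  move=> uc; rewrite -[RHS]subr0 -{1}(z0 _ uc) -(sbdry_sbdry y' u) -sbdryB.
  apply: eq_sbdry => g gu; case: (leqP g m) => gm.
    by rewrite /z1 restr_in //; apply: collar_setU1.
  (* A vertex above [m] leads out of every support, so the restriction in [z1] loses nothing. *)
  have out (v : {set 'I_N}) j p : g \in v -> ~ collar j p m v.
    by move=> gv [_ /(_ g gv)]; rewrite leqNgt gm.
  rewrite z1s; last by case=> vc _; exact: (out _ _ _ (setU11 _ _) vc).
  rewrite zs; last by apply: out; rewrite setU11.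
  rewrite /sbdry big1 ?subr0 // => h _; rewrite y's ?linear0 ?scaler0 //.
  by apply: out; rewrite !in_setU1 eqxx orbT.
(* The degeneracy repeats the position at which [qo] is inserted, and the sign is the one with which
   [sbdry] removes [qo]; hence that face gives back [z1]. *)
pose y1 (u : {set 'I_N}) : Y r.+2 := if qo \in u then
  (-1) ^+ rank u q *: degen Y r.+1 (rank u q) (z1 (u :\ qo)) else 0.
exists (fun u => y' u + y1 u) => [u nc|u uc].
  rewrite y's ?add0r; last by move=> /collarS[].
  rewrite /y1; case: ifP => // qu; rewrite z1s ?linear0 ?scaler0 // => -[uc _].
  by apply: nc; rewrite -(setD1K qu); apply: collar_setU1; rewrite ?setD11 // ltnW.
rewrite sbdryD; have -> : sbdry y1 u = z1 u; last by rewrite /z1 restr_in // addrCA subrr addr0.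
have [qu|qu] := boolP (qo \in u); last first.
  rewrite /sbdry (bigD1 qo) //= big1 ?addr0 => [|g /andP[gu gq]]; last first.
    rewrite /y1 in_setU1 (negPf qu) orbF eq_sym (negPf gq).
    by rewrite linear0 scaler0.
  rewrite /y1 setU11 setU1K // rank_setU1 // ltnn linearZ scalerA /=.
  rewrite -expr2 sqrr_sign scale1r face_degen_id //.
  (* The vertex m lies in [u] above [qo], which keeps the index of the degeneracy in range. *)
  have mu : Ordinal mN \in u by case: uc => _ _; apply; rewrite qm leqnn.
  rewrite -ltnS; case: uc => <- _ _.
  exact: leq_ltn_trans (leq_rank u (ltnW qm)) (rank_lt_card mu).
have {}y's : z1 u = 0 by apply: z1s; rewrite qu => -[].
pose u0 := u :\ qo; have u0q : qo \notin u0 by rewrite setD11.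
have uE : u = qo |: u0 by rewrite setD1K.
have u0c : collar r q.+1 m u0.
  case: uc => ur um uq; split=> [|g|g qg].
  - by move: ur; rewrite {1}uE cardsU1 u0q => -[].
  - by rewrite in_setD1 => /andP[_ /um].
  by rewrite in_setD1 uq // andbT -val_eqE /=; lia.
(* Only vertices below [qo] contribute: those from there to m are already in [u], those above m
   leave the support. Their faces commute with the degeneracy by [face_degen_lt], which leaves a
   degeneracy of the boundary of [z1] at [u0]. *)
rewrite y's; transitivity (- (-1) ^+ rank u q *: degen Y r (rank u q) (sbdry z1 u0)); last first.
  by rewrite z10 // linear0 scaler0.
rewrite /sbdry [in RHS](bigD1 qo) //= -uE y's linear0 scaler0 add0r.
rewrite linear_sum scaler_sumr /=.
apply: eq_big => [g|g gu]; first by rewrite uE in_setU1 negb_or andbC.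
have gq : g != qo by apply: contraNneq gu => ->.
have gu0 : g \notin u0 by rewrite in_setD1 (negPf gu) andbF.
have gE : (g |: u) :\ qo = g |: u0.
  by rewrite uE setUCA setU1K // in_setU1 negb_or eq_sym gq.
rewrite /y1 in_setU1 qu orbT gE rank_setU1 //.
case: (leqP g m) => gm; last first.
  rewrite z1s ?linear0 ?scaler0 ?linear0 ?scaler0 // => -[[_ /(_ g)]].
  by rewrite setU11 leqNgt gm => /(_ isT).
have {}gq : (g < q)%N.
  rewrite ltn_neqAle -(inj_eq val_inj) in gq *; rewrite gq leqNgt.
  by apply: contra gu => qg; case: uc => _ _; apply; rewrite qg.
have -> : rank u g = rank u0 g by rewrite uE rank_setU1 //= ltnNge ltnW.
have le : (rank u0 g <= rank u q)%N.
  by rewrite (leq_trans (leq_rank _ (ltnW gq))) // [u in leqRHS]uE rank_setU1 // leq_addl.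
rewrite gq add1n linearZ /= face_degen_lt //= scalerA linearZ /= scalerA.
by rewrite exprS mulN1r mulrC.
Qed.

End Collapse.

(** * Homology of the simplex with simplicial coefficients *)

Section SimplexHomology.
Variables (k : comNzRingType) (Y : simplicial_module k) (n : nat).
Implicit Types (u v : {set 'I_n.+1}).

Definition below r m u : Prop := #|u| = r /\ forall g : 'I_n.+1, g \in u -> (g <= m)%N.

Lemma sbdry_supported r (z : {set 'I_n.+1} -> Y r.+1) :
  supported (fun u => #|u| = r.+1) z -> supported (fun u => #|u| = r) (sbdry z).
Proof.
move=> zs u ur; rewrite /sbdry big1 // => g gu; rewrite zs ?linear0 ?scaler0 //.
by rewrite cardsU1 gu => -[].
Qed.

(** The top vertex is discarded as long as it exceeds [r]: by [collar_acyclic] with [q] equal to it,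
    a boundary cancels the cycle on all faces containing that vertex. *)
Lemma simplex_reduce r m (z : {set 'I_n.+1} -> Y r.+1) :
  (m <= n)%N -> (r <= m)%N -> supported (below r.+1 m) z ->
  (forall u, sbdry z u = 0) ->
  exists2 y : {set 'I_n.+1} -> Y r.+2, supported (fun u => #|u| = r.+2) y
    & supported (below r.+1 r) (fun u => z u - sbdry y u).
Proof.
elim: m z => [|m IH] z mn rm zs z0.
  move: rm; rewrite leqn0 => /eqP r0; exists (fun=> 0) => // u ub.
  rewrite /sbdry big1 ?subr0 => [|g _]; last by rewrite linear0 scaler0.
  by apply: zs; rewrite -r0.
move: rm; rewrite leq_eqVlt => /orP[/eqP rm|rm].
  exists (fun=> 0) => // u ub.
  rewrite /sbdry big1 ?subr0 => [|g _]; last by rewrite linear0 scaler0.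
  by apply: zs; rewrite -rm.
have mN : (m.+1 < n.+1)%N by [].
pose mo : 'I_n.+1 := Ordinal mN.
have collarE j u : collar j m.+1 m.+1 u <-> below j m.+1 u /\ mo \in u.
  split=> [[uj um uq]|[[uj um] mu]]; split=> //; first by apply: uq; rewrite /= leqnn.
  move=> g /andP[mg gm]; rewrite (_ : g = mo) //; apply/val_inj/eqP.
  by rewrite eqn_leq gm.
have [|u /collarE [ub mu]|y ys yz] :=
    @collar_acyclic k Y _ r m.+1 m.+1 (restr (fun u => mo \in u) z) mN (leqnn _) rm.
- move=> u nc; rewrite /restr; case: asboolP => // mu; apply: zs => ub.
  by apply/nc/collarE.
- rewrite -[RHS](z0 u); apply: eq_sbdry => g _; apply: restr_in.
  by rewrite in_setU1 mu orbT.
have {}ys : supported (below r.+2 m.+1) y by move=> u nb; apply: ys => -[? ? _]; apply: nb.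
have yc : supported (fun u => #|u| = r.+2) y by move=> u nu; apply: ys => -[].
have ds : supported (below r.+1 m.+1) (sbdry y).
  move=> u nb; rewrite /sbdry big1 // => g gu; rewrite ys ?linear0 ?scaler0 //.
  move=> [ur um]; apply: nb; split.
    by move: ur; rewrite cardsU1 gu => -[].
  by move=> h hu; apply: um; rewrite in_setU1 hu orbT.
have [|u|y2 y2c y2s] := IH (fun u => z u - sbdry y u) (ltnW mn) rm.
- move=> u nb; have [[ur um]|nb'] := pselect (below r.+1 m.+1 u); last first.
    by rewrite zs // ds // subrr.
  have [mu|mu] := boolP (mo \in u).
    by rewrite yz ?restr_in ?subrr //; apply/collarE.
  case: nb; split=> // g gu; have := um g gu; rewrite leq_eqVlt => /orP[/eqP e|//].
  by move: mu; rewrite (_ : mo = g) ?gu //; apply/val_inj.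
- by rewrite sbdryB z0 sbdry_sbdry subrr.
exists (fun u => y u + y2 u) => u nu; first by rewrite yc ?y2c ?addr0.
by rewrite sbdryD opprD addrA y2s.
Qed.

Definition initial r : {set 'I_n.+1} := [set g : 'I_n.+1 | (g < r)%N].

Lemma card_initial r : (r <= n.+1)%N -> #|initial r| = r.
Proof.
move=> rn; transitivity (rank (initial r) r); last first.
  by apply: rank_initial => // g; rewrite inE.
by rewrite rank_all // => g; rewrite inE.
Qed.

Lemma belowE r u : (r <= n)%N -> below r.+1 r u -> u = initial r.+1.
Proof.
move=> rn [ur um]; apply/eqP; rewrite eqEcard card_initial // ur leqnn andbT.
by apply/subsetP => g /um; rewrite inE ltnS.
Qed.

Lemma chain_sum_surj r (x : Y r.+1) : (r <= n)%N -> (forall i, face Y r i x = 0) ->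
  let z u := if u == initial r.+1 then x else 0 in
  [/\ supported (fun u => #|u| = r.+1) z, forall u, sbdry z u = 0 & chain_sum z = x].
Proof.
move=> rn x0 z; split=> [u ur|u|].
- by rewrite /z; case: eqP => // uE; case: ur; rewrite uE card_initial.
- by rewrite /sbdry big1 // => g _; rewrite /z; case: ifP => _; rewrite ?x0 !linear0.
rewrite /chain_sum (bigD1 (initial r.+1)) //= {1}/z eqxx big1 ?addr0 // => u.
by rewrite /z => /negPf ->.
Qed.

(** The cycle is first moved onto the single face {0, ..., r}. Its value there bounds, and after
    normalization it bounds an element whose last face alone may be nonzero; this element is placed
    on {0, ..., r + 1}, which exists because [r < n]. *)
Lemma chain_sum_inj r (z : {set 'I_n.+1} -> Y r.+1) (x : Y r.+2) : (r < n)%N ->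
  supported (fun u => #|u| = r.+1) z -> (forall u, sbdry z u = 0) ->
  chain_sum z = bdry x ->
  exists2 y : {set 'I_n.+1} -> Y r.+2, supported (fun u => #|u| = r.+2) y
    & forall u, sbdry y u = z u.
Proof.
move=> rn zs z0 zx.
have [|y ys yz] := @simplex_reduce r n z (leqnn n) (ltnW rn) _ z0.
  by move=> u nb; apply: zs => ur; apply: nb; split=> // g _; rewrite -ltnS.
pose z1 u := z u - sbdry y u; pose x1 := z1 (initial r.+1).
have z1E u : u != initial r.+1 -> z1 u = 0.
  by move=> /eqP nu; apply: yz => /belowE -/(_ (ltnW rn)).
have z10 u : sbdry z1 u = 0 by rewrite sbdryB z0 sbdry_sbdry subrr.
have x1b : bdry (x - chain_sum y) = x1.
  rewrite linearB /= -zx -chain_sum_sbdry // /chain_sum -sumrB.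
  by rewrite (bigD1 (initial r.+1)) //= big1 ?addr0 // => u /z1E.
(* At the face lacking vertex i, the cycle condition has a single possibly nonzero term: face i of
   [x1]. *)
have x10 i : face Y r i x1 = 0.
  have [ri|ir] := ltnP r i; first exact: face_out.
  pose g : 'I_n.+1 := inord i.
  have gE : g = i :> nat by rewrite inordK // ltnS (leq_trans ir (ltnW rn)).
  have gi : g \in initial r.+1 by rewrite inE gE.
  have := z10 (initial r.+1 :\ g); rewrite /sbdry (bigD1 g) ?setD11 //=.
  rewrite setD1K // big1 ?addr0 => [|h /andP[hu hg]]; last first.
    rewrite z1E ?linear0 ?scaler0 //; apply: contraNneq hg => /setP /(_ g).
    by rewrite gi in_setU1 setD11 orbF eq_sym => ->.
  have -> : rank (initial r.+1 :\ g) g = i.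
    rewrite -[RHS]gE rank_initial ?(ltnW (ltn_ord g)) // => h hg.
    by rewrite in_setD1 -val_eqE /= neq_ltn hg inE gE (ltn_trans hg) ?gE.
  move=> /(congr1 (fun t => (-1) ^+ i *: t)).
  by rewrite scalerA -expr2 sqrr_sign scale1r scaler0.
pose y1 := moore r.+1 (x - chain_sum y).
have y1b : bdry y1 = x1 by apply: moore_bdry.
have y10 i : (i <= r)%N -> face Y r.+1 i y1 = 0 by move=> ir; apply: moore_face.
(* All faces of [y1] but the last vanish, so the boundary of [w] is carried by [initial r.+1]
   alone. *)
pose w u := if u == initial r.+2 then y1 else 0.
exists (fun u => y u + w u) => [u ur|u].
  rewrite ys // add0r /w; case: eqP => // uE; case: ur.
  by rewrite uE card_initial.
rewrite sbdryD; have -> : sbdry w u = z1 u; last by rewrite addrCA subrr addr0.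
have w0 g : g \notin u -> u != initial r.+1 ->
    face Y r.+1 (rank u g) (w (g |: u)) = 0.
  move=> gu uN; rewrite /w; case: eqP => [/setP guE|]; last by rewrite linear0.
  have ug h : (h \in u) = (h != g) && (h < r.+2)%N.
    have := guE h; rewrite in_setU1 inE; case: eqP => [-> _|_ /= <- //].
    exact: negPf.
  have gr : (g < r.+2)%N by have := guE g; rewrite setU11 inE => /esym.
  have [gr1|gr1] := eqVneq (g : nat) r.+1.
    case/eqP: uN; apply/setP => h; rewrite ug inE -val_eqE /= gr1.
    by rewrite [in RHS]ltn_neqAle -ltnS.
  rewrite y10 // rank_initial ?(ltnW (ltn_ord g)) //; first by rewrite -ltnS ltn_neqAle gr1 -ltnS.
  by move=> h hg; rewrite ug -val_eqE /= neq_ltn hg (ltn_trans hg).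
have [->|uN] := eqVneq u (initial r.+1); last first.
  rewrite z1E // /sbdry big1 // => g gu.
  by rewrite w0 // scaler0.
have rN : (r.+1 < n.+1)%N by [].
pose go := Ordinal rN.
have guE : go |: initial r.+1 = initial r.+2.
  by apply/setP => h; rewrite !inE -val_eqE /= [in RHS]ltnS [in RHS]leq_eqVlt.
rewrite /sbdry (bigD1 go) ?inE ?ltnn //= guE big1 ?addr0 => [|g /andP[gu gg]]; last first.
  rewrite /w; case: eqP => [/setP /(_ g)|_]; last by rewrite linear0 scaler0.
  rewrite setU11 inE => /esym; rewrite ltnS leq_eqVlt => /orP[/eqP e|].
    by case/eqP: gg; apply/val_inj.
  by move: gu; rewrite inE => /negPf ->.
rewrite rank_initial ?(ltnW rN) //; last by move=> h; rewrite inE.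
rewrite /w eqxx -[RHS]/x1 -y1b /bdry big_ord_recr /= big1 ?add0r // => i _.
by rewrite y10 ?scaler0 // -ltnS.
Qed.

End SimplexHomology.

(** * The Hochschild simplicial module *)

Section Tensors.
Variables (k : comNzRingType) (A : lmodType k).

(* Factors indexed by [nat] avoid casts between ordinals; those from the [m]-th
   on are ignored. *)
Definition ntens m (v : nat -> A) : tpow A m := tens [ffun c : 'I_m => v c].

Lemma eq_ntens m (v v' : nat -> A) :
  (forall c, (c < m)%N -> v c = v' c) -> ntens m v = ntens m v'.
Proof. by move=> e; congr tens; apply/ffunP => c; rewrite !ffunE e. Qed.

Lemma tens_ntens m (w : {ffun 'I_m -> A}) : exists v, tens w = ntens m v.
Proof.
exists (fun c => if insub c is Some c' then w c' else 0).
by congr tens; apply/ffunP => c; rewrite ffunE valK.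
Qed.

Lemma tpow_ext m (V : lmodType k) (f g : tpow A m -> V) :
  linear f -> linear g -> (forall v, f (ntens m v) = g (ntens m v)) -> f =1 g.
Proof.
move=> fl gl fg; elim/tens_ind => [|a w t e]; last first.
  by have [v ->] := tens_ntens w; rewrite fl gl fg e.
have f0 (h : tpow A m -> V) : linear h -> h 0 = 0.
  by move=> hl; have := hl (-1) 0 0; rewrite scaler0 addr0 scaleN1r addNr.
by rewrite !f0.
Qed.

End Tensors.

(** * Faces and degeneracies of the cyclic bar construction *)

Section HochschildModule.
Variables (k : comNzRingType) (A : algType k).

(** Faces into the dummy [tpow A 0] are zero, in accordance with the zero boundary on C_0. *)
Definition hface m (i : nat) : {linear tpow A m.+1 -> tpow A m} :=
  match m with
  | 0 => \0
  | _ => if insub i is Some i' then hoch_face_map A i' else \0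
  end.

Definition nface m i (v : nat -> A) c : A :=
  if i == m then if c == 0%N then v m * v 0%N else v c
  else if (c < i)%N then v c else if c == i then v c * v c.+1 else v c.+1.

Lemma hface_out m i x : (m < i)%N -> hface m i x = 0.
Proof.
case: m x => // m x mi; rewrite /hface; case: insubP => //= j jm ji.
by move: (ltn_ord j); rewrite ji ltnS leqNgt mi.
Qed.

Lemma hface0 i x : hface 0 i x = 0. Proof. by []. Qed.

Lemma hface_ntens m i v : (0 < m)%N -> (i <= m)%N ->
  hface m i (ntens m.+1 v) = ntens m (nface m i v).
Proof.
case: m => // m _ im; rewrite /hface; case: insubP => [j _ ji|]; last first.
  by rewrite ltnS im.
rewrite [LHS]tens_liftE; congr tens; apply/ffunP => c.
rewrite !ffunE /= -!val_eqE /= /bump ji /nface !leq0n add1n.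
by rewrite [(m.+1 <= c)%N]leqNgt ltn_ord add0n.
Qed.

(** The bar degeneracy: a unit is inserted after entry [j]. *)
Definition ndegen j (v : nat -> A) c : A :=
  if (c <= j)%N then v c else if c == j.+1 then 1 else v c.-1.

Definition hoch_degen m (j : 'I_m.+1) (w : {ffun 'I_m.+1 -> A}) : {ffun 'I_m.+2 -> A} :=
  [ffun c : 'I_m.+2 => ndegen j (fun d => w (inord d)) c].

Lemma hoch_degen_multilinear m j : multilinear (fun w => tens (@hoch_degen m j w)).
Proof.
pose posn (u : nat) := if (u <= j)%N then u else u.+1.
pose pos (u : 'I_m.+1) : 'I_m.+2 := inord (posn u).
have posE u : pos u = posn u :> nat.
  by rewrite inordK // /posn; have := ltn_ord u; case: ifP; lia.
apply: (multilinear_tens (pos := pos)) => [w u x c|w u a x y].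
  have := (ltn_ord u, ltn_ord j, ltn_ord c) => -[[um jm] cm].
  rewrite -val_eqE /= posE /posn !ffunE /ndegen => ci; case: ifPn => cj.
    rewrite ffunE -val_eqE /= inordK; last by lia.
    by case: eqP => // e; exfalso; move: ci; case: ifP; lia.
  case: ifPn => // cj'.
  by rewrite ffunE -val_eqE /= inordK; [case: eqP => // e; exfalso; move: ci; case: ifP; lia | lia].
have := (ltn_ord u, ltn_ord j) => -[um jm].
rewrite !ffunE /ndegen posE /posn; case: (leqP u j) => uj.
  by rewrite uj !ffunE -val_eqE /= inordK // eqxx.
by rewrite ltnNge (ltnW uj) /= !ffunE -val_eqE /= inordK // eqxx eqSS (gtn_eqF uj).
Qed.

Definition hdegen m (j : nat) : {linear tpow A m -> tpow A m.+1} :=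
  match m with
  | 0 => \0
  | _ => if insub j is Some j' then tens_lift (@hoch_degen_multilinear _ j') else \0
  end.

Lemma hdegen_out m j x : (m <= j)%N -> hdegen m j x = 0.
Proof.
case: m x => // m x mi; rewrite /hdegen; case: insubP => //= i im ij.
by move: (ltn_ord i); rewrite ij ltnNge mi.
Qed.

Lemma hdegen_ntens m j v : (j < m)%N ->
  hdegen m j (ntens m v) = ntens m.+1 (ndegen j v).
Proof.
case: m => // m jm; rewrite /hdegen; case: insubP => [i _ ij|]; last by rewrite jm.
rewrite [LHS]tens_liftE; congr tens; apply/ffunP => c.
have cm := ltn_ord c; rewrite !ffunE /ndegen ij.
case: ifP => cj; first by rewrite ffunE inordK //; lia.
by case: ifP => // cj'; rewrite ffunE inordK //; lia.
Qed.

(** It suffices to compare entries of pure tensors. Associativity enters when the two multiplied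
    pairs overlap, possibly around the end of the cycle. *)
Lemma hface_hface m i j x : (i < j)%N ->
  hface m i (hface m.+1 j x) = hface m j.-1 (hface m.+1 i x).
Proof.
move=> ij; case: m x => // m x.
have [jm|jm] := ltnP m.+2 j.
  by rewrite (@hface_out m.+2 j) // linear0 (@hface_out m.+1 j.-1) //; lia.
move: x; apply: tpow_ext => [a y z|a y z|v]; rewrite ?linearP //.
have jm1 : (j.-1 <= m.+1)%N by lia.
have im : (i <= m.+1)%N by lia.
have im2 : (i <= m.+2)%N by lia.
rewrite !hface_ntens //; apply: eq_ntens => c cm; rewrite /nface.
by repeat case: ifPn => ?; first [exfalso; lia
  | rewrite ?mulrA; repeat congr (_ * _); congr (v _); lia].
Qed.

Lemma hface_hdegen_lt m i j x : (i < j)%N ->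
  hface m.+1 i (hdegen m.+1 j x) = hdegen m j.-1 (hface m i x).
Proof.
move=> ij; have [jm|jm] := leqP m.+1 j.
  by rewrite [in LHS]hdegen_out // linear0 hdegen_out //; lia.
have im : (i <= m)%N by lia.
move: x; apply: tpow_ext => [a y z|a y z|v]; rewrite ?linearP //.
rewrite hdegen_ntens // !hface_ntens ?hdegen_ntens //; try lia.
apply: eq_ntens => c cm; rewrite /nface /ndegen.
by repeat case: ifPn => ?; first [exfalso; lia
  | repeat congr (_ * _); first [congr (v _); lia | done]].
Qed.

Lemma hface_hdegen_id m j x : (j <= m)%N -> hface m.+1 j (hdegen m.+1 j x) = x.
Proof.
move=> jm; move: x; apply: (@tpow_ext _ _ _ _ _ id) => [a y z|a y z|v]; rewrite ?linearP //.
rewrite hdegen_ntens // hface_ntens ?(leqW jm) //.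
apply: eq_ntens => c cm; rewrite /nface /ndegen.
by repeat case: ifPn => ?; first [exfalso; lia
  | rewrite ?mulr1; congr (v _); lia].
Qed.

Lemma hface_hdegen_idS m j x : (j <= m)%N -> hface m.+1 j.+1 (hdegen m.+1 j x) = x.
Proof.
move=> jm; move: x; apply: (@tpow_ext _ _ _ _ _ id) => [a y z|a y z|v]; rewrite ?linearP //.
rewrite hdegen_ntens // hface_ntens //.
apply: eq_ntens => c cm; rewrite /nface /ndegen.
by repeat case: ifPn => ?; first [exfalso; lia
  | rewrite ?mul1r; congr (v _); lia].
Qed.

Lemma hface_hdegen_gt m i j x : (j.+1 < i)%N ->
  hface m.+1 i (hdegen m.+1 j x) = hdegen m j (hface m i.-1 x).
Proof.
move=> ij; have [im|im] := ltnP m.+1 i.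
  rewrite [in LHS]hface_out // hface_out ?linear0 //; lia.
move: x; apply: tpow_ext => [a y z|a y z|v]; rewrite ?linearP //.
rewrite hdegen_ntens ?hface_ntens ?hdegen_ntens //; try lia.
apply: eq_ntens => c cm; rewrite /nface /ndegen.
by repeat case: ifPn => ?; first [exfalso; lia
  | repeat congr (_ * _); first [congr (v _); lia | done]].
Qed.

Definition hoch_simplicial : simplicial_module k :=
  SimplicialModule hface_out hface_hface hface_hdegen_lt
  hface_hdegen_id hface_hdegen_idS hface_hdegen_gt.

Lemma hoch_bdryE r (x : tpow A r.+1) : hoch_bdry x = bdry (Y := hoch_simplicial) x.
Proof.
rewrite /bdry; case: r x => [|r] x /=; first by rewrite big_ord1 scaler0.
apply: eq_bigr => i _; congr (_ *: _).
by case: insubP => [j _ /val_inj ->|]; rewrite ?ltn_ord.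
Qed.

End HochschildModule.

(** * Components of the states of the polygon *)

Section Components.
Variable n : nat.
Local Notation N := n.+1.
Implicit Types (u : {set 'I_N}) (e v p : 'I_N).

(* A state is described by the initial vertices of the edges it lacks. *)
Definition state u : {set 'I_N} := [set e | src e \notin u].
Definition gaps (s : {set 'I_N}) : {set 'I_N} := [set p | ordS p \notin s].

Lemma src_inj : injective (@src N). Proof. exact: can_inj (@ord_predK N). Qed.

Lemma stateK : cancel state gaps.
Proof. by move=> u; apply/setP => p; rewrite !inE negbK /src ordSK. Qed.

Lemma gapsK : cancel gaps state.
Proof. by move=> s; apply/setP => e; rewrite !inE negbK /src ord_predK. Qed.

Lemma card_state u : #|state u| = (N - #|u|)%N.
Proof.
rewrite -(card_imset _ src_inj); transitivity #|~: u|; last first.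
  by rewrite cardsCs setCK card_ord.
apply: eq_card => p; rewrite inE; apply/imsetP/idP => [[e es ->]|pu].
  by rewrite inE in es.
by exists (ordS p); rewrite ?inE /src ordSK.
Qed.

Lemma state_setU1 u e : src e \notin u -> e |: state (src e |: u) = state u.
Proof.
move=> eu; apply/setP => f; rewrite !inE (inj_eq src_inj) negb_or.
by case: eqP => [->|] //=; rewrite eu.
Qed.

Lemma srcE e : src e = (if e == 0%N :> nat then n else e.-1) :> nat.
Proof.
rewrite /=; case: eqP => [->|/eqP e0]; first by rewrite add0n /= modn_small.
have -> : (e + N).-1 = (e.-1 + N)%N by lia.
by rewrite modnDr modn_small // (leq_ltn_trans (leq_pred _)).
Qed.

Lemma rankS u p : rank u p.+1 = ((p \in u) + rank u p)%N.
Proof. by case: (boolP (p \in u)) => pu; [rewrite rankS_in | rewrite rankS_notin]. Qed.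

(** Moving along [e] raises the rank by one exactly when [e] is missing. The congruence takes care
    of the edge from v_n to v_0, where the count restarts. *)
Lemma rank_tgt u e : rank u (tgt e) = (src e \in u) + rank u (src e) %[mod #|u|].
Proof.
rewrite -rankS srcE /tgt; case: eqP => [->|/eqP e0]; last by rewrite prednK ?lt0n.
by rewrite [in RHS]rank_all // modnn /rank big1 ?mod0n.
Qed.

Lemma connect_arc u v v' : (v <= v')%N ->
  (forall p, (v <= p)%N -> (p < v')%N -> p \notin u) -> connect (adj (state u)) v v'.
Proof.
have [m] := ubnP v'; elim: m v' => // m IH v' vm; rewrite leq_eqVlt.
case/orP => [/eqP /val_inj -> //|vv'] arc.
have v'0 : v' == 0%N :> nat = false by apply: gtn_eqF; apply: leq_ltn_trans vv'.
have sv' : src v' = v'.-1 :> nat by rewrite srcE v'0.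
apply: connect_trans (_ : connect _ v (src v')) _; last first.
  by apply/connect1/adj_edge; rewrite inE arc // sv'; lia.
apply: IH => [||p vp pv']; rewrite ?sv'; try lia.
by apply: arc => //; lia.
Qed.

(** By [rank_tgt] the rank modulo [#|u|] is constant along the edges present. Conversely, no gap
    separates vertices of equal rank, and ranks 0 and [#|u|] are joined through the edge from v_n to
    v_0. *)
Lemma connect_state u v v' :
  connect (adj (state u)) v v' = (rank u v == rank u v' %[mod #|u|]).
Proof.
have edge e : e \in state u -> rank u (src e) = rank u (tgt e) %[mod #|u|].
  by rewrite inE rank_tgt => /negPf ->.
apply/idP/eqP => [/connectP[p pP ->]|].
  elim: p v pP => //= x p IH v /andP[/existsP[e /andP[es]]].
  by case/orP => /andP[/eqP <- /eqP <-] /IH <-; rewrite edge.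
have sym := adj_sym (state u).
wlog vv' : v v' / (v <= v')%N => [wl|].
  by case/orP: (leq_total v v') => /wl // w /esym; rewrite sym.
have le := leq_rank u vv'; have le' := rank_card u v'.
move=> /eqP; rewrite eq_sym eqn_mod_dvd // => dv.
have [e|/eqP] := eqVneq (rank u v) (rank u v').
  apply: connect_arc => // p vp pv'; apply/negP => pu.
  by have := leq_ltn_trans (leq_rank u vp) (rank_lt pu pv'); rewrite e ltnn.
move=> ne; have dvl := dvdn_leq _ dv.
(* Both ranks lie between 0 and [#|u|], so a nonzero difference divisible by [#|u|] forces these
   extreme values. *)
have v0 : rank u v = 0%N by lia.
have vk : rank u v' = #|u| by lia.
apply: (connect_trans (y := ord0)).
  rewrite sym; apply: connect_arc => // p _ pv; apply/negP => pu.
  by have := rank_lt pu pv; rewrite v0.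
apply: (connect_trans (y := ord_max)); last first.
  rewrite sym; apply: connect_arc => [|p vp _]; first by rewrite -ltnS ltn_ord.
  apply/negP => pu; have := leq_trans (rank_lt_card pu) (eq_leq (esym vk)).
  by rewrite ltnNge leq_rank.
have s0 : src (ord0 : 'I_N) = ord_max by apply: val_inj; rewrite [LHS]srcE.
rewrite -[X in connect _ _ X]s0 sym; apply/connect1/adj_edge; rewrite inE s0.
apply/negP => pu; have := rank_lt_card pu; rewrite -vk ltnNge leq_rank //.
by rewrite -ltnS ltn_ord.
Qed.

(** Both lists are strictly increasing and have the same members. Hence component number c is the
    class of rank c. *)
Lemma map_rank_least u : (0 < #|u|)%N ->
  [seq (rank u (v : 'I_N) %% #|u|)%N | v <- least_seq (state u)] = iota 0 #|u|.
Proof.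
move=> u0; apply: (irr_sorted_eq ltn_trans ltnn); rewrite ?iota_ltn_sorted //.
  rewrite sorted_map; pose P := [pred v | least_in_comp (state u) v].
  apply: (@sub_in_sorted _ P (relpre val ltn)).
  - move=> v v' vl vl' /= vv'.
    have ne : rank u v != rank u v' %[mod #|u|].
      rewrite -connect_state; apply: contraTN vv' => /(least_uniq vl vl') ->.
      by rewrite ltnn.
    have [vk|vk] := ltnP (rank u v') #|u|.
      have le := leq_rank u (ltnW vv').
      move: ne; rewrite (modn_small vk) (modn_small (leq_ltn_trans le vk)) => ne.
      by rewrite ltn_neqAle ne.
    have {}vk : rank u v' = #|u| by apply/eqP; rewrite eqn_leq rank_card.
    (* A vertex of rank [#|u|] lies in the component of vertex 0, so it is least there only if it is
       0. *)
    have : connect (adj (state u)) v' ord0.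
      by rewrite connect_state vk modnn [rank u ord0]big1 ?mod0n.
    move: vl' => /forallP /(_ ord0) /implyP vl' /vl'.
    by rewrite leqn0 => /eqP v'0; rewrite v'0 in vv'.
  - by apply/allP => v; rewrite mem_filter => /andP[].
  - apply: sorted_filter => [a b c|]; first exact: ltn_trans.
    by rewrite -sorted_map val_enum_ord iota_ltn_sorted.
move=> j; rewrite mem_iota add0n; apply/mapP/idP => [[v _ ->]|ju]; first exact: ltn_pmod.
have [g gu gj] := rank_onto ju.
have [v gv vl] := exists_least (state u) g.
exists v; first by rewrite mem_filter vl mem_enum.
by move: gv; rewrite connect_state => /eqP <-; rewrite gj modn_small.
Qed.

(** Without gaps the whole polygon is still one component, so [u] must be nonempty. *)
Lemma ncomp_state u : (0 < #|u|)%N -> ncomp (state u) = #|u|.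
Proof.
move=> /map_rank_least /(congr1 size); rewrite size_map size_iota => <-.
by rewrite (eqP (size_least_seq_ncomp (state u))).
Qed.

Lemma comp_of_state u v : (0 < #|u|)%N ->
  comp_of (state u) v = (rank u v %% #|u|)%N :> nat.
Proof.
move=> u0; have := comp_ofP (state u) v; rewrite connect_state => /eqP ->.
set c := comp_of _ v.
rewrite comp_vertex.unlock (tnth_nth ord0) /=.
have cT : (c < size (least_seq (state u)))%N.
  by rewrite (eqP (size_least_seq_ncomp (state u))).
rewrite -(nth_map ord0 0%N (fun v : 'I_N => rank u v %% #|u|)%N) //.
by rewrite map_rank_least // nth_iota // -ncomp_state.
Qed.

End Components.

(** * Transport between tensor powers with equal exponents *)

Section TensorCast.
Variables (k : comNzRingType) (A : lmodType k).

(* The identity when [m = m'], and the junk value 0 otherwise. *)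
Definition tcast m m' (x : tpow A m) : tpow A m' :=
  if m =P m' is ReflectT e then ecast r (tpow A r) e x else 0.

Lemma tcast_id m x : @tcast m m x = x.
Proof. by rewrite /tcast; case: eqP => // e; rewrite eq_axiomK. Qed.

Fact tcast_is_linear m m' : linear (@tcast m m').
Proof.
move=> a x y; have [<-|/eqP ne] := eqVneq m m'; first by rewrite !tcast_id.
by rewrite /tcast; case: eqP => // _; rewrite scaler0 addr0.
Qed.
HB.instance Definition _ m m' :=
  GRing.isLinear.Build k (tpow A m) (tpow A m') *:%R (@tcast m m') (@tcast_is_linear m m').

Lemma tcast0 m m' : @tcast m m' 0 = 0. Proof. exact: linear0. Qed.

Lemma tcastK m m' : m = m' -> cancel (@tcast m m') (@tcast m' m).
Proof. by case: m' / => x; rewrite !tcast_id. Qed.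

Lemma tcast_tens m m' (w : {ffun 'I_m -> A}) (v : nat -> A) : m = m' ->
  (forall c, w c = v c) -> tcast m' (tens w) = ntens m' v.
Proof.
case: m' / => wv; rewrite tcast_id /ntens; congr tens.
by apply/ffunP => c; rewrite ffunE wv.
Qed.

Lemma tcast_ntens m m' v : m = m' -> tcast m' (ntens m v) = ntens (A := A) m' v.
Proof. by move=> e; apply: tcast_tens => // c; rewrite ffunE. Qed.

End TensorCast.

(* Inserting a gap of rank [i] (with [x] the rank of a vertex [v] before the
   insertion, [b] telling whether [v] comes after the gap) numbers the components
   as the cyclic face [i] does. *)
Lemma nface_merge (k : comNzRingType) (A : algType k) r (i x c : nat) (b : bool) (v : nat -> A) :
  (i <= r.+1)%N -> (x <= r.+1)%N -> (c < r.+1)%N -> (x %% r.+1)%N = c ->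
  (if b then (i <= x)%N else (x <= i)%N) ->
  (if c == (i %% r.+1)%N then v (i %% r.+2)%N * v (i.+1 %% r.+2)%N
   else v ((b + x) %% r.+2)%N) = nface r.+1 i v c.
Proof.
move=> ir xr cr xc xi; rewrite /nface.
have -> : (i %% r.+2)%N = i by rewrite modn_small.
have {}xc : if (x < r.+1)%N then x = c else x = r.+1 /\ c = 0%N.
  case: ifP => xlt; first by rewrite -xc modn_small.
  have xe : x = r.+1 by apply/eqP; rewrite eqn_leq xr leqNgt xlt.
  by rewrite -xc xe modnn.
have [ilt|ige] := ltnP i r.+1.
  rewrite (modn_small ilt) (ltn_eqF ilt) [(i.+1 %% _)%N]modn_small //.
  case: eqP => [->|ci]; first by rewrite ltnn.
  move: xc; case: b xi => xi; case: ifP => xlt.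
  - move=> xc; have cx : (i < c)%N by lia.
    rewrite ltnNge (ltnW cx) /= xc add1n modn_small //; lia.
  - move=> [xe c0]; rewrite xe add1n modnn c0 (_ : 0 < i)%N //; lia.
  - move=> xc; have cx : (c < i)%N by lia.
    by rewrite xc add0n cx modn_small // ltnW.
  - by move=> [xe c0]; exfalso; lia.
have {ir ige} ir : i = r.+1 by apply/eqP; rewrite eqn_leq ir.
rewrite ir modnn eqxx modnn; case: eqP => // c0.
by move: xc; case: b xi => xi; case: ifP => xlt xc; try lia;
   rewrite xc add0n modn_small //; lia.
Qed.

(** * Adding an edge as a Hochschild face *)

Section EdgeMap.
Variables (n : nat) (k : comNzRingType) (A : algType k).
Local Notation N := n.+1.
Implicit Types (s u : {set 'I_N}) (e v : 'I_N).

Lemma gaps_setU1 s e : e \notin s -> gaps s = src e |: gaps (e |: s).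
Proof.
move=> es; apply/setP => p; rewrite !inE negb_or -[e in ordS p == e]ord_predK.
by rewrite (inj_eq (can_inj (@ordSK _))); case: eqP => //= ->; rewrite ord_predK es.
Qed.

Lemma src_gaps s e : (src e \in gaps s) = (e \notin s).
Proof. by rewrite inE ord_predK. Qed.

Lemma ncompE s : (0 < #|gaps s|)%N -> ncomp s = #|gaps s|.
Proof. by move=> /ncomp_state; rewrite gapsK. Qed.

Lemma comp_ofE s v : (0 < #|gaps s|)%N ->
  comp_of s v = (rank (gaps s) v %% #|gaps s|)%N :> nat.
Proof.
(* The copy [s'] separates the occurrence to be replaced from the one inside [gaps s]. *)
have H s' : s' = state (gaps s) -> (0 < #|gaps s|)%N ->
    comp_of s' v = (rank (gaps s) v %% #|gaps s|)%N :> nat.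
  by move=> ->; apply: comp_of_state.
by apply: H; rewrite gapsK.
Qed.

Lemma card_gaps_setU1 s e : e \notin s -> #|gaps s| = #|gaps (e |: s)|.+1.
Proof. by move=> es; rewrite (gaps_setU1 es) cardsU1 src_gaps setU11. Qed.

(** The ends of a missing edge have consecutive ranks modulo the number of gaps, and these differ as
    soon as there are two gaps. *)
Lemma same_compN s e : e \notin s -> (0 < #|gaps (e |: s)|)%N -> ~~ same_comp s e.
Proof.
move=> es g0; rewrite /same_comp -val_eqE /= !comp_ofE ?(card_gaps_setU1 es) //.
have eg : src e \in gaps s by rewrite src_gaps.
rewrite -(card_gaps_setU1 es) rank_tgt eg add1n.
have := rank_lt_card eg; have := card_gaps_setU1 es.
move: #|_| (rank _ _) => q x qE xq; rewrite modn_small //.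
have [xq1|qx] := ltnP x.+1 q; first by rewrite modn_small //; lia.
have -> : x.+1 = q by lia.
by rewrite modnn; lia.
Qed.

(** On pure tensors: by [comp_ofE] components are numbered by ranks before and after the gap at
    [src e] is closed, and [nface_merge] compares the two numberings. *)
Lemma edge_map_face s e (x : states A s) r : e \notin s ->
  #|gaps (e |: s)| = r.+1 ->
  tcast r.+1 (edge_map A s e x) =
  hface A r.+1 (rank (gaps (e |: s)) (src e)) (tcast r.+2 x).
Proof.
move=> es gr; have gr2 : #|gaps s| = r.+2 by rewrite (card_gaps_setU1 es) gr.
have eg : src e \in gaps s by rewrite src_gaps.
have eg' : src e \notin gaps (e |: s) by rewrite src_gaps setU11.
have rk w : rank (gaps s) w = ((src e < w) + rank (gaps (e |: s)) w)%N.
  by rewrite (gaps_setU1 es) rank_setU1.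
have sc := same_compN es; rewrite gr in sc; have {}sc := sc isT.
have rs : ncomp s = r.+2 by rewrite ncompE gr2.
have rs' : ncomp (e |: s) = r.+1 by rewrite ncompE gr.
have cE w : comp_of s w = (rank (gaps s) w %% r.+2)%N :> nat.
  by rewrite comp_ofE gr2.
have cE' w : comp_of (e |: s) w = (rank (gaps (e |: s)) w %% r.+1)%N :> nat.
  by rewrite comp_ofE gr.
have [i iE] : {i | rank (gaps (e |: s)) (src e) = i} by eexists.
have ir : (i <= r.+1)%N by rewrite -iE -gr rank_card.
have si : rank (gaps s) (src e) = i by rewrite rk ltnn.
move: x; apply: tpow_ext => [a y z|a y z|v].
- by rewrite 2!linearP.
- by rewrite 2!linearP.
rewrite iE tcast_ntens // hface_ntens // [edge_map A s e _]tens_liftE.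
apply: tcast_tens => // c; rewrite mergeE sc /= !ffunE -val_eqE /= cE' iE.
have c_lt : (c < r.+1)%N by rewrite -[X in (_ < X)%N]rs'.
have cv : (rank (gaps (e |: s)) (comp_vertex c) %% r.+1)%N = c.
  by rewrite -cE' comp_vertexK.
have tE : (rank (gaps s) (tgt e) %% r.+2)%N = (i.+1 %% r.+2)%N.
  by have := rank_tgt (gaps s) e; rewrite gr2 si eg add1n.
rewrite !cE tE si rk; apply: nface_merge => //.
  by rewrite -gr rank_card.
rewrite -iE; case: ifP => ev; first exact: leq_rank (ltnW ev).
by apply: leq_rank; rewrite leqNgt ev.
Qed.

End EdgeMap.

(** * Comparison of the complexes *)

Section Transfer.
Variables (n : nat) (k : comNzRingType) (A : algType k).
Local Notation N := n.+1.
Local Notation Y := (hoch_simplicial A).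
Variable leE : rel 'I_N.
Hypotheses (leE_anti : antisymmetric leE) (leE_total : total leE).
Implicit Types (s u : {set 'I_N}) (e f : 'I_N).

(* The number of inversions makes up for the choice of [leE], and the sum of the
   positions turns the number of smaller edges into the number of a face. *)
Definition twist_by (p : 'I_N -> nat) s : nat :=
  (\sum_(f in s) (p f + \sum_(f' in s) ((p f < p f') && leE f' f)))%N.
Definition twist s : nat := twist_by (fun f => src f) s.

Lemma rank_setC u (x : nat) : (x <= N)%N -> (rank u x + rank (~: u) x)%N = x.
Proof.
move=> xN; transitivity (rank [set: 'I_N] x); last by apply: rank_initial => // g _; rewrite inE.
rewrite /rank [RHS](bigID (mem u)) /=; by congr (_ + _)%N; apply: eq_bigl => h; rewrite !inE.
Qed.

Lemma rank_gaps s (x : nat) : (x <= N)%N ->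
  (rank (gaps s) x + \sum_(f in s) (src f < x))%N = x.
Proof.
move=> xN; apply: etrans (rank_setC (gaps s) xN); congr (_ + _)%N.
rewrite /rank [RHS](reindex (@src N)) /=; last exact/onW_bij/(Bijective (@ord_predK _))/ordSK.
by apply: eq_bigl => f; rewrite in_setC src_gaps negbK.
Qed.

Lemma twist_by_setU1 p s e : e \notin s ->
  twist_by p (e |: s) = (twist_by p s + (p e + \sum_(f in s) ((p f < p e)%N && leE e f)
    + \sum_(f in s) ((p e < p f)%N && leE f e)))%N.
Proof.
move=> es; rewrite /twist_by.
rewrite big_setU1 //= big_setU1 //= ltnn add0n.
have -> : (\sum_(i in s) (p i + \sum_(f' in e |: s) ((p i < p f') && leE f' i))
   = \sum_(i in s) ((p i < p e) && leE e i) +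
     \sum_(i in s) (p i + \sum_(f' in s) ((p i < p f') && leE f' i)))%N.
  by rewrite -big_split; apply: eq_bigr => i _ /=; rewrite big_setU1 //= addnCA.
by rewrite addnA [RHS]addnC; congr (_ + _)%N; rewrite addnAC.
Qed.

Lemma nsmallerE s e : e \notin s -> nsmaller leE s e = (\sum_(f in s) leE f e)%N.
Proof.
move=> es; rewrite /nsmaller -sum1_card big_mkcond [RHS]big_mkcond /=.
apply: eq_bigr => f _; rewrite inE; case: (boolP (f \in s)) => //= fs.
have -> : f != e by apply: contraNneq es => <-.
by case: (leE f e).
Qed.

(** By [rank_gaps], [src e] is the rank plus the number of [f] in [s] with a smaller source. For
    each such or other [f] in [s], this indicator, [leE f e] and the inversion of the pair add up to
    an even number. *)
Lemma sign_twist s e : e \notin s ->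
  (-1) ^+ twist (e |: s) * (-1) ^+ nsmaller leE s e =
  (-1) ^+ twist s * (-1) ^+ rank (gaps (e |: s)) (src e) :> k.
Proof.
move=> es; rewrite -!exprD -[LHS]signr_odd -[RHS]signr_odd; congr (_ ^+ nat_of_bool _).
rewrite /twist twist_by_setU1 // nsmallerE // -addnA !oddD; congr (_ (+) _).
have xN : (src e <= N)%N by rewrite ltnW.
have := rank_gaps s xN; rewrite (gaps_setU1 es) rank_setU1 ?src_gaps ?setU11 // ltnn add0n.
set q := rank _ _ => qE; rewrite -{1}qE.
rewrite -!oddD -!addnA oddD -[RHS]addbF; congr (_ (+) _).
rewrite -!big_split /=.
elim/big_rec: _ => //= f j fs IH; rewrite oddD IH addbF.
have fe : e != f by apply: contraNneq es => ->.
have : leE f e || leE e f by apply: leE_total.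
have : ~~ (leE f e && leE e f).
  by apply: contra fe => le; apply/eqP/leE_anti; rewrite andbC.
have : src f != src e :> nat.
  by rewrite -[_ != _]/(val _ != val _) (inj_eq val_inj) (inj_eq (@src_inj _)) eq_sym.
by case: ltngtP => // _; case: (leE f e); case: (leE e f).
Qed.

Local Notation cochains := (cochains N A).

(** The exponent [ncomp (state u)] equals [#|u|] only by a theorem, for nonempty [u]; hence the
    cast. *)
Definition chain_of r (x : cochains) u : Y r :=
  (-1) ^+ twist (state u) *: tcast r (ds_coord (state u) x).

Definition cochain_of r (z : {set 'I_N} -> Y r) : cochains :=
  ds_make (fun s => (-1) ^+ twist s *: tcast (ncomp s) (z (gaps s)) : states A s).

Fact chain_of_is_linear r u : linear (fun x => chain_of r x u).
Proof.
by move=> a x y; rewrite /chain_of [ds_coord _ _]linearP [tcast _ _]linearP scalerDr !scalerA mulrC.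
Qed.

Lemma cochain_ofK r (z : {set 'I_N} -> Y r) u : (0 < r)%N ->
  supported (fun u => #|u| = r) z -> chain_of r (cochain_of z) u = z u.
Proof.
move=> r0 zs; rewrite /chain_of ds_makeE [tcast _ _]linearZ scalerA -expr2 sqrr_sign scale1r.
rewrite stateK; have [ur|/eqP ur] := eqVneq #|u| r; last by rewrite zs // !linear0.
by apply: tcastK; rewrite ncomp_state ?ur.
Qed.

Lemma card_gaps s : (#|gaps s| + #|s|)%N = N.
Proof.
have := max_card (mem (gaps s)); rewrite card_ord => le.
by rewrite -{2}(gapsK s) card_state addnC subnK.
Qed.

Lemma cochains_inE i x : x \in cochains_in N A i <-> forall s, #|s| != i -> ds_coord s x = 0.
Proof. exact: submodule_ofE. Qed.

Lemma cochain_of_in r i (z : {set 'I_N} -> Y r) : (r + i)%N = N ->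
  supported (fun u => #|u| = r) z -> cochain_of z \in cochains_in N A i.
Proof.
move=> ri zs; apply/cochains_inE => s si; rewrite ds_makeE zs ?tcast0 ?scaler0 //.
by move=> gr; have := card_gaps s; move/eqP: si; lia.
Qed.

Lemma chain_of_supported r i x : (r + i)%N = N -> x \in cochains_in N A i ->
  supported (fun u => #|u| = r) (chain_of r x).
Proof.
move=> ri /cochains_inE xi u ur; rewrite /chain_of xi ?tcast0 ?scaler0 //.
by have := card_gaps (state u); rewrite stateK; apply: contraPneq => ->; lia.
Qed.

Lemma chain_of_inj r i x y : (0 < r)%N -> (r + i)%N = N ->
  x \in cochains_in N A i -> y \in cochains_in N A i ->
  (forall u, chain_of r x u = chain_of r y u) -> x = y.
Proof.
move=> r0 ri /cochains_inE xi /cochains_inE yi xy; apply/ds_eqP => s.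
have [si|si] := eqVneq #|s| i; last by rewrite xi ?yi.
have gr : #|gaps s| = r by have := card_gaps s; lia.
have := xy (gaps s); rewrite /chain_of gapsK.
move=> /(congr1 (fun t => (-1) ^+ twist s *: t)).
rewrite !scalerA -expr2 sqrr_sign !scale1r; apply: can_inj (tcastK _) _ _.
by rewrite ncompE gr.
Qed.

End Transfer.

(** * The codifferential as the boundary on the simplex *)

Section Codifferential.
Variables (n : nat) (k : comNzRingType) (A : algType k).
Local Notation N := n.+1.
Local Notation Y := (hoch_simplicial A).
Local Notation cochains := (cochains N A).
Variable leE : rel 'I_N.
Hypotheses (leE_anti : antisymmetric leE) (leE_total : total leE).
Implicit Types (s u : {set 'I_N}) (e f : 'I_N).

Local Notation chain_of := (chain_of leE).
Local Notation cochain_of := (cochain_of leE).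
Variable Phi : forall s e, {linear states A s -> states A (e |: s)}.
Local Notation codiff := (codiff leE Phi).

Lemma tcast_coord s s' m (x : states A s') :
  tcast m (ds_coord s (@ds_inj k _ (states A) s' x)) = if s' == s then tcast m x else 0.
Proof.
by case: eqVneq => [<-|ss]; [rewrite ds_inj_eq | rewrite ds_inj_neq // tcast0].
Qed.

(** The summands live over [e |: (t :\ e)], whose states are a different type from those over [t];
    the cast brings them all into [tpow A m]. *)
Lemma tcast_codiff t m x : tcast m (ds_coord t (codiff x)) =
  \sum_(e in t) (-1) ^+ nsmaller leE (t :\ e) e *:
    tcast m (@Phi (t :\ e) e (ds_coord (t :\ e) x)).
Proof.
rewrite /codiff 2!linear_sum /=.
under eq_bigr => s _ do rewrite 2!linear_sum /=.
rewrite (exchange_big_dep xpredT) //= [RHS]big_mkcond /=; apply: eq_bigr => e _.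
under eq_bigr => s _ do rewrite 2!linearZ /= tcast_coord.
case: ifP => et; last first.
  rewrite big1 // => s es; case: eqP => [st|]; last by rewrite scaler0.
  by rewrite -st setU11 in et.
have tE : e |: (t :\ e) == t by rewrite setD1K.
rewrite (bigD1 (t :\ e)) ?setD11 //= tE big1 ?addr0 // => s /andP[es st].
case: eqP => [stE|]; last by rewrite scaler0.
by rewrite -stE setU1K // eqxx in st.
Qed.

(** Adding [e] closes the gap [src e], a face by [edge_map_face]; [sign_twist] matches the signs. *)
Lemma chain_of_codiff r x u : (0 < #|u|)%N -> #|u| = r ->
  (forall s e y, e \notin s -> e |: s = state u -> Phi s e y = edge_map A s e y) ->
  chain_of r (codiff x) u = sbdry (chain_of r.+1 x) u.
Proof.
case: r => [|r] u0 ur PhiE; first by rewrite ur in u0.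
rewrite /chain_of tcast_codiff scaler_sumr /sbdry.
rewrite [RHS](reindex (@src N)); last exact/onW_bij/(Bijective (@ord_predK _))/ordSK.
apply: eq_big => [e|e eu']; first by rewrite inE.
have eu : src e \notin u by rewrite inE in eu'.
have sE : state (src e |: u) = state u :\ e.
  by rewrite -(state_setU1 eu) setU1K // inE negbK setU11.
have eu1 : e \notin state u :\ e by rewrite setD11.
have eE : e |: (state u :\ e) = state u by rewrite setD1K.
have gE : gaps (e |: (state u :\ e)) = u by rewrite eE stateK.
have gr : #|gaps (e |: (state u :\ e))| = r.+1 by rewrite gE.
rewrite PhiE // (edge_map_face _ eu1 gr). rewrite [gaps _]gE sE [face _ _ _ _]linearZ !scalerA.
have := sign_twist k leE_anti leE_total eu1; rewrite eE stateK => ->.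
by congr (_ *: _); rewrite mulrC.
Qed.

Lemma codiff_in i x : x \in cochains_in N A i -> codiff x \in cochains_in N A i.+1.
Proof.
move=> /cochains_inE xi; apply/cochains_inE => t ti.
rewrite -(tcast_id (ds_coord t _)) tcast_codiff big1 // => e et.
rewrite xi ?linear0 ?scaler0 //; apply: contraNneq ti => <-.
by rewrite -{1}(setD1K et) cardsU1 setD11.
Qed.

End Codifferential.

(** * Graded isomorphisms *)

Section GradedIso.
Variable k : comNzRingType.

Lemma submod_span_gen (V : lmodType k) (P : V -> Prop) x : P x -> x \in submod_span P.
Proof. by move=> Px; apply/submod_spanP => S; apply. Qed.

Lemma submod_span_map (V W : lmodType k) (f : {linear V -> W}) (P : V -> Prop)
    (S : submodule W) x :
  (forall y, P y -> f y \in S) -> x \in submod_span P -> f x \in S.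
Proof.
move=> PS /submod_spanP xP.
have F0 : f 0 \in S by rewrite linear0 rpred0.
have FL a y z : f y \in S -> f z \in S -> f (a *: y + z) \in S.
  by move=> Sy Sz; rewrite linearP rpredD // rpredZ.
by apply/(submodule_ofE F0 FL)/xP => y /PS fy; apply/submodule_ofE.
Qed.

Definition in_submod (V : lmodType k) (S : submodule V) x (xS : x \in S) : submod S :=
  exist (fun x => x \in S) x xS.

Lemma bij_of_inj_surj (T T' : Type) (f : T -> T') :
  injective f -> (forall y, exists x, f x = y) -> bijective f.
Proof.
by move=> fi /choice[h hK]; exists h => // x; apply: fi; rewrite hK.
Qed.

Lemma gr_iso_deg_part (M W : grmod k) j : gr_iso M W ->
  lmod_iso (deg_part M j) (deg_part W j).
Proof.
case=> f [[h fK hK] fd].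
pose g (x : deg_part M j) : deg_part W j :=
  in_submod (etrans (esym (fd j (val x))) (valP x)).
have gl : linear g by move=> a x y; apply/val_inj; rewrite /= linearP.
pose gL := GRing.isLinear.Build k _ _ *:%R g gl.
exists (HB.pack g gL : {linear _ -> _}).
apply: bij_of_inj_surj => [x y /= /(congr1 val) /= xy|y].
  by apply/val_inj/(can_inj fK).
have hy : h (val y) \in gr_deg M j by rewrite fd hK; exact: (valP y).
by exists (in_submod hy); apply/val_inj; rewrite /= hK.
Qed.

Lemma mem_submod_restrict (V : lmodType k) (Z B : submodule V) x :
  (x \in submod_restrict Z B) <-> val x \in B.
Proof. exact: submodule_ofE. Qed.

Lemma mem_quot_image (V : lmodType k) (S D : submodule V) q :
  (q \in quot_image S D) <-> exists2 x, x \in D & q = quot_pi S x.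
Proof. exact: submodule_ofE. Qed.

Lemma mem_gr_subquot (M : grmod k) (Z B : submodule M) j (q : gr_subquot Z B) :
  (q \in gr_deg (gr_subquot Z B) j) <->
  exists2 x, val x \in gr_deg M j & q = quot_pi (submod_restrict Z B) x.
Proof.
apply: (iff_trans (mem_quot_image _ _)).
by split=> -[x /mem_submod_restrict xd ->]; exists x => //; apply/mem_submod_restrict.
Qed.

Lemma gr_subquot_iso (M W : grmod k) (Z B : submodule M) (g : {linear submod Z -> W}) :
  (forall x, g x = 0 <-> val x \in B) -> (forall w, exists x, g x = w) ->
  (forall j x, val x \in gr_deg M j -> g x \in gr_deg W j) ->
  (forall j w, w \in gr_deg W j -> exists2 x, val x \in gr_deg M j & g x = w) ->
  gr_iso (gr_subquot Z B) W.
Proof.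
move=> gB gs gd gds; pose R := submod_restrict Z B.
have RE x : (x \in R) <-> val x \in B by apply: mem_submod_restrict.
pose f (q : quotmod R) : W := g (repr q).
have fE x : f (quot_pi R x) = g x.
  apply/eqP; rewrite -subr_eq0 -linearB; apply/eqP/gB/RE.
  by apply/quot_piP; rewrite quot_pi_reprK.
have fl : linear f.
  move=> a x y; rewrite -(quot_pi_reprK x) -(quot_pi_reprK y) -linearP.
  by rewrite !fE linearP.
pose fL := GRing.isLinear.Build k _ _ *:%R f fl.
exists (HB.pack f fL : {linear gr_subquot Z B -> W}); split=> [|j q /=].
  apply: bij_of_inj_surj => [p q /= pq|w].
    rewrite -(quot_pi_reprK p) -(quot_pi_reprK q).
    by apply/quot_piP/RE/gB; rewrite linearB; apply/eqP; rewrite subr_eq0; apply/eqP.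
  by have [x <-] := gs w; exists (quot_pi R x); apply: fE.
apply/idP/idP => [/mem_gr_subquot[x xd ->]|/gds[x xd xq]].
  by rewrite fE gd.
apply/mem_gr_subquot; exists x => //.
rewrite -(quot_pi_reprK q); apply/quot_piP/RE/gB.
by rewrite linearB /= xq subrr.
Qed.

(** The last hypothesis gives surjectivity and, since the same [x] has every degree that [w] has,
    also makes the inverse preserve degrees. *)
Lemma gr_subquot_map_iso (M W : grmod k) (Z B : submodule M) (Z' B' : submodule W)
    (g : {linear M -> W}) :
  (forall x, x \in Z -> g x \in Z') ->
  (forall x, x \in Z -> (g x \in B' <-> x \in B)) ->
  (forall j x, x \in gr_deg M j -> g x \in gr_deg W j) ->
  (forall w, w \in Z' -> exists x, [/\ x \in Z, w - g x \in B'
     & forall j, w \in gr_deg W j -> x \in gr_deg M j]) ->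
  gr_iso (gr_subquot Z B) (gr_subquot Z' B').
Proof.
move=> gZ gB gd gs; pose R := submod_restrict Z' B'.
have RE x : (x \in R) <-> val x \in B' by apply: mem_submod_restrict.
pose g1 (x : submod Z) : submod Z' := in_submod (gZ _ (valP x)).
pose f x : gr_subquot Z' B' := quot_pi R (g1 x).
have fl : linear f.
  move=> a x y; rewrite /f -linearP; congr quot_pi.
  by apply/val_inj; rewrite /= linearP.
have f0 y z : quot_pi R y = quot_pi R z <-> val y - val z \in B'.
  have -> : val y - val z = val (y - z) by rewrite linearB.
  by split=> [/quot_piP yz|/RE yz]; [apply/RE | apply/quot_piP].
pose fL := GRing.isLinear.Build k _ _ *:%R f fl.
apply: (gr_subquot_iso (g := HB.pack f fL)) => [x|w|j x xd|j w].
- rewrite /= /f -[X in _ = X](linear0 (quot_pi R)) f0 /= subr0.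
  exact: gB (valP x).
- rewrite -(quot_pi_reprK w) /=.
  have [x [xZ xw _]] := gs _ (valP (repr w)); exists (in_submod xZ).
  by apply/esym/f0.
- by apply/mem_gr_subquot; exists (g1 x) => //; apply: gd.
case/mem_gr_subquot => y yd ->.
have [x [xZ xw xd]] := gs _ (valP y); exists (in_submod xZ); first exact: xd.
by apply/esym/f0.
Qed.

Lemma gr_subquot_eq_iso (M : grmod k) (Z B Z' B' : submodule M) :
  (forall x, (x \in Z) <-> (x \in Z')) -> (forall x, (x \in B) <-> (x \in B')) ->
  gr_iso (gr_subquot Z B) (gr_subquot Z' B').
Proof.
move=> ZE BE.
apply: (@gr_subquot_map_iso M M _ _ _ _ (idfun : {linear M -> M})) => [x /ZE|x _|j x|x xZ] //.
  exact: iff_sym (BE x).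
exists x; split=> //; first exact/ZE.
by rewrite subrr rpred0.
Qed.

End GradedIso.

(** * Faces, degeneracies and casts preserve the internal degree *)

Section Degrees.
Variables (k : comNzRingType) (A : algType k) (G : grading A).

Lemma ntens_deg m v (dg : nat -> int) :
  (forall c, (c < m)%N -> v c \in G (dg c)) ->
  ntens m v \in gr_deg (gr_tpow G m) (\sum_(0 <= c < m) dg c).
Proof.
move=> vd; apply: submod_span_gen; exists [ffun c : 'I_m => v c], (fun c : 'I_m => dg c).
by split=> // [c|]; rewrite ?ffunE ?vd // big_mkord.
Qed.

Lemma tpow_deg_map m j (V : lmodType k) (S : submodule V) (f : {linear tpow A m -> V}) x :
  (forall v dg, (forall c, (c < m)%N -> v c \in G (dg c)) ->
     \sum_(0 <= c < m) dg c = j -> f (ntens m v) \in S) ->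
  x \in gr_deg (gr_tpow G m) j -> f x \in S.
Proof.
move=> fS; apply: submod_span_map => _ [w [dg [wd dj ->]]].
pose v c := if insub c is Some c' then w c' else 0.
pose dg' c := if insub c is Some c' then dg c' else 0.
have -> : tens w = ntens m v.
  by congr tens; apply/ffunP => c; rewrite ffunE /v valK.
apply: (fS v dg') => [c cm|]; first by rewrite /v /dg' insubT.
by rewrite -dj big_mkord; apply: eq_bigr => c _; rewrite /dg' valK.
Qed.

Lemma face_deg m i j x : x \in gr_deg (gr_tpow G m.+1) j ->
  face (hoch_simplicial A) m i x \in gr_deg (gr_tpow G m) j.
Proof.
case: m x => [|m] x; first by rewrite [face _ _ _ _]hface0 rpred0.
have [im|im] := ltnP m.+1 i; first by rewrite face_out ?rpred0.
apply: tpow_deg_map => v dg vd <-; rewrite [face _ _ _ _]hface_ntens //.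
(* The degrees of the entries of the face: those of the two multiplied entries add up, so the total
   is unchanged. *)
pose dg' c := if i == m.+1 then if c == 0%N then dg m.+1 + dg 0%N else dg c
  else if (c < i)%N then dg c else if c == i then dg c + dg c.+1 else dg c.+1.
have <- : \sum_(0 <= c < m.+1) dg' c = \sum_(0 <= c < m.+2) dg c.
  rewrite /dg'; have [_|im'] := eqVneq i m.+1.
    rewrite big_nat_recl //= [RHS]big_nat_recr //= [X in _ = X + _]big_nat_recl //=.
    by rewrite [RHS]addrC addrA.
  have {im im'} im : (i < m.+1)%N by lia.
  rewrite (big_cat_nat (n := i)) ?leq0n ?(ltnW im) //=.
  rewrite [RHS](big_cat_nat (n := i)) ?leq0n ?leqW ?(ltnW im) //=.
  congr (_ + _); first by apply: eq_big_nat => c /andP[_ ->].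
  rewrite big_ltn // [RHS]big_ltn ?(leqW im) // [in RHS](big_ltn (m := i.+1)) //.
  rewrite ltnn eqxx -addrA; congr (_ + (_ + _)).
  rewrite [RHS]big_add1 /=; apply: eq_big_nat => c /andP[ic _].
  by rewrite ltnNge (ltnW ic) (gtn_eqF ic).
apply: ntens_deg => c cm; rewrite /nface /dg'.
by repeat case: ifPn => ?; first [apply: homogM; apply: vd; lia | apply: vd; lia].
Qed.

Lemma degen_deg m i j x : x \in gr_deg (gr_tpow G m) j ->
  degen (hoch_simplicial A) m i x \in gr_deg (gr_tpow G m.+1) j.
Proof.
have [im|im] := leqP m i; first by rewrite [degen _ _ _ _]hdegen_out ?rpred0.
apply: tpow_deg_map => v dg vd <-; rewrite [degen _ _ _ _]hdegen_ntens //.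
pose dg' c := if (c <= i)%N then dg c else if c == i.+1 then 0 else dg c.-1.
have <- : \sum_(0 <= c < m.+1) dg' c = \sum_(0 <= c < m) dg c.
  rewrite /dg' (big_cat_nat (n := i.+1)) ?leq0n ?leqW //=.
  rewrite [RHS](big_cat_nat (n := i.+1)) ?leq0n //=.
  congr (_ + _); first by apply: eq_big_nat => c /andP[_]; rewrite ltnS => ->.
  rewrite big_ltn // ltnn eqxx add0r big_add1 /=.
  apply: eq_big_nat => c /andP[ic _].
  by rewrite ltnNge (ltnW ic) eqSS (gtn_eqF ic).
apply: ntens_deg => c cm; rewrite /ndegen /dg'.
by repeat case: ifPn => ?; first [exact: homog1 | apply: vd; lia].
Qed.

Lemma tcast_deg m m' j (x : tpow A m) : x \in gr_deg (gr_tpow G m) j ->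
  tcast m' x \in gr_deg (gr_tpow G m') j.
Proof.
have [<-|/eqP ne] := eqVneq m m'; first by rewrite tcast_id.
by rewrite /tcast; case: eqP => // _; rewrite rpred0.
Qed.

End Degrees.

(** * Cohomology of the polygon *)

Section PolygonCohomology.
Variables (n : nat) (k : comNzRingType) (A : algType k) (G : grading A).
Local Notation N := n.+1.
Local Notation Y := (hoch_simplicial A).
Variable leE : rel 'I_N.
Hypotheses (leE_anti : antisymmetric leE) (leE_total : total leE).
Implicit Types (s u : {set 'I_N}) (e f : 'I_N).

Local Notation dhat := (codiff leE (@edge_map_hat N k A)).
Local Notation dplain := (codiff leE (@edge_map N k A)).
Local Notation Zhat := (cocycles leE (@edge_map_hat N k A)).
Local Notation Bhat := (coboundaries leE (@edge_map_hat N k A)).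
Local Notation Zplain := (cocycles leE (@edge_map N k A)).
Local Notation Bplain := (coboundaries leE (@edge_map N k A)).
Local Notation cochains := (cochains N A).

Lemma mem_cocycles Phi i (x : cochains) :
  (x \in cocycles leE Phi i) <-> x \in cochains_in N A i /\ codiff leE Phi x = 0.
Proof. exact: submodule_ofE. Qed.

Lemma mem_coboundaries Phi i (x : cochains) :
  (x \in coboundaries leE Phi i) <-> exists2 y : cochains,
    (forall s, #|s|.+1 != i -> ds_coord s y = 0) & x = codiff leE Phi y.
Proof. exact: submodule_ofE. Qed.

Lemma mem_coboundariesS Phi i (x : cochains) :
  (x \in coboundaries leE Phi i.+1) <->
  exists2 y, y \in cochains_in N A i & x = codiff leE Phi y.
Proof.
by split=> [/mem_coboundaries|] [y yi ->]; [|apply/mem_coboundaries];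
  exists y => //; [apply/cochains_inE => s si; apply: yi | apply/cochains_inE].
Qed.

Lemma mem_gr_cochains j (x : cochains) :
  (x \in gr_deg (gr_cochains N G) j) <->
  forall s, ds_coord s x \in gr_deg (gr_tpow G (ncomp s)) j.
Proof. exact: submodule_ofE. Qed.

Lemma edge_map_hatE s e x : e \notin s -> (0 < #|gaps (e |: s)|)%N ->
  edge_map_hat A s e x = edge_map A s e x.
Proof. by move=> es g0; rewrite /edge_map_hat (negPf (same_compN es g0)). Qed.

Lemma edge_map_hat_last s e x : #|gaps s| = 1%N -> edge_map_hat A s e x = 0.
Proof.
move=> g1; rewrite /edge_map_hat ifT //.
by rewrite /same_comp -val_eqE /= !comp_ofE g1 // !modn1.
Qed.

(** From degree below [n], an added edge leaves at least one gap, so it never closes the polygon. *)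
Lemma codiff_hat i (x : cochains) : (i < n)%N -> x \in cochains_in N A i ->
  dhat x = dplain x.
Proof.
move=> i_n /cochains_inE xi; apply: eq_bigr => s _; apply: eq_bigr => e es.
congr (_ *: ds_inj _).
have [si|si] := eqVneq #|s| i; last by rewrite xi // [LHS]linear0 [RHS]linear0.
rewrite edge_map_hatE //.
by have := card_gaps s; rewrite (card_gaps_setU1 es); lia.
Qed.

Lemma chain_of_hat r x u : #|u| = r.+1 ->
  chain_of leE r.+1 (dhat x) u = sbdry (chain_of leE r.+2 x) u.
Proof.
move=> ur; apply: chain_of_codiff => //; first by rewrite ur.
by move=> s e y es eu; rewrite edge_map_hatE // eu stateK ur.
Qed.

Lemma chain_of0 r u : chain_of leE (A := A) r 0 u = 0.
Proof. by rewrite /chain_of [ds_coord _ 0]linear0 [tcast _ 0]linear0 scaler0. Qed.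

(** For positive [r] this is [chain_of_hat]. For [r = 0] both conditions are empty: faces into the
    dummy [tpow A 0] are zero, and so is the last hatted differential. *)
Lemma cocycles_hat r i x : (r + i)%N = n ->
  (x \in Zhat i) <-> x \in cochains_in N A i /\
    forall u, sbdry (chain_of leE r.+1 x) u = 0.
Proof.
move=> rin; have ri : (r.+1 + i)%N = N by rewrite addSn rin.
split=> [/mem_cocycles[xi x0]|[xi x0]].
  split=> // u; have [ur|/eqP ur] := eqVneq #|u| r; last first.
    by apply: sbdry_supported ur; apply: chain_of_supported xi.
  case: r ur ri {rin} => [|r] ur ri.
    by rewrite /sbdry big1 // => g _; rewrite [face _ _ _ _]hface0 scaler0.
  by rewrite -chain_of_hat // x0 chain_of0.
apply/mem_cocycles; split=> //; have := codiff_in leE (@edge_map_hat N k A) xi.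
case: r rin ri x0 => [|r] rin ri x0 dx.
  apply/ds_eqP => t; rewrite linear0 -[LHS](tcast_id (ds_coord t _)).
  have [ti|ti] := eqVneq #|t| i.+1; last first.
    by move/cochains_inE: dx => -> //; rewrite tcast0.
  rewrite tcast_codiff big1 // => e et; rewrite edge_map_hat_last ?linear0 ?scaler0 //.
  have := card_gaps (t :\ e); have := cardsD1 e t; rewrite et ti; lia.
apply: (@chain_of_inj _ _ _ leE r.+1 i.+1) => //; first by rewrite -ri addnS.
  exact: rpred0.
move=> u; rewrite chain_of0.
have [ur|/eqP ur] := eqVneq #|u| r.+1; first by rewrite chain_of_hat.
by apply: chain_of_supported dx _ ur; rewrite -ri addnS.
Qed.

Definition to_hoch r (x : cochains) : tpow A r := chain_sum (chain_of leE (A := A) r x).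

Fact to_hoch_is_linear r : linear (to_hoch r).
Proof.
move=> a x y; rewrite /to_hoch /chain_sum scaler_sumr -big_split.
by apply: eq_bigr => u _; apply: chain_of_is_linear.
Qed.
HB.instance Definition _ r :=
  GRing.isLinear.Build k cochains (tpow A r) *:%R (to_hoch r) (@to_hoch_is_linear r).

Lemma mem_hoch_cycles r (x : tpow A r.+1) :
  (x \in hoch_cycles A r) <-> bdry (Y := Y) x = 0.
Proof. by rewrite -hoch_bdryE; apply: submodule_ofE. Qed.

Lemma mem_hoch_boundaries r (x : tpow A r.+1) :
  (x \in hoch_boundaries A r) <-> exists y : Y r.+2, x = bdry y.
Proof.
apply: (iff_trans (submodule_ofE _ _ _)).
by split=> -[y ->]; exists y; rewrite hoch_bdryE.
Qed.

(** Forgetting the faces is a chain map, injective in homology by [chain_sum_inj]; [0 < i] supplies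
    the required [r < n]. *)
Lemma coboundaries_hat r i x : (r + i)%N = n -> (0 < i)%N ->
  x \in Zhat i -> (to_hoch r.+1 x \in hoch_boundaries A r) <-> x \in Bhat i.
Proof.
case: i => // i rin _ xZ; have ri : (r.+2 + i)%N = N by rewrite !addSn -addnS rin.
have [xi x0] := (cocycles_hat x rin).1 xZ.
have ri1 : (r.+1 + i.+1)%N = N by rewrite addSn rin.
have xs := chain_of_supported leE ri1 xi.
split=> [/mem_hoch_boundaries[w xw]|/mem_coboundariesS[y yi xy]].
  have rn : (r < n)%N by lia.
  have [y ys yx] := chain_sum_inj rn xs x0 xw.
  apply/mem_coboundariesS; exists (cochain_of leE y); first exact: cochain_of_in.
  apply: (chain_of_inj (leE := leE) (r := r.+1) _ ri1) => // [|u].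
    by apply: codiff_in; apply: cochain_of_in.
  have [ur|/eqP ur] := eqVneq #|u| r.+1; last first.
    rewrite xs // (chain_of_supported leE ri1 _ ur) //.
    by apply: codiff_in; apply: cochain_of_in.
  rewrite chain_of_hat // -yx; apply: eq_sbdry => g _.
  by rewrite cochain_ofK.
apply/mem_hoch_boundaries; exists (to_hoch r.+2 y).
rewrite /to_hoch -chain_sum_sbdry; last exact: chain_of_supported yi.
apply: eq_bigr => u _; have [ur|/eqP ur] := eqVneq #|u| r.+1.
  by rewrite xy chain_of_hat.
by rewrite xs // sbdry_supported //; apply: chain_of_supported yi.
Qed.

Lemma hat_iso r i : (r + i)%N = n -> (0 < i)%N ->
  gr_iso (graph_cohomology_hat G leE i) (HH G r).
Proof.
move=> rin i0; have ri : (r.+1 + i)%N = N by rewrite addSn rin.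
have rn : (r < n)%N by lia.
apply: (@gr_subquot_map_iso _ (gr_cochains N G) (gr_tpow G r.+1) _ _ _ _
  (to_hoch r.+1)) => [x|x|j x|w].
- move=> /(cocycles_hat x rin)[xi x0]; apply/mem_hoch_cycles.
  rewrite -chain_sum_sbdry; last exact: chain_of_supported xi.
  by rewrite /chain_sum big1.
- exact: coboundaries_hat.
- move=> /mem_gr_cochains xd.
  have cd u : chain_of leE r.+1 x u \in gr_deg (gr_tpow G r.+1) j.
    by apply: rpredZ; apply: tcast_deg; apply: xd.
  by apply: (big_ind (fun t => t \in gr_deg (gr_tpow G r.+1) j)) => // [|a b];
    [apply: rpred0 | apply: rpredD].
move=> /mem_hoch_cycles w0.
(* Surjectivity: [w] is homologous to its normalization, whose faces all vanish and which can
   therefore sit alone on {0, ..., r}. *)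
have [y wy] := moore_homologous (Y := Y) (leqnn r) w0.
have [zs z0 zw] := chain_sum_surj (ltnW rn) (fun i => moore_cycle (Y := Y) i w0).
set z := (fun u => if _ then _ else _) in zs z0 zw.
exists (cochain_of leE z); split=> [||j wd].
- apply/(cocycles_hat _ rin); split; first exact: cochain_of_in.
  by move=> u; rewrite -[RHS](z0 u); apply: eq_sbdry => g _; rewrite cochain_ofK.
- apply/mem_hoch_boundaries; exists y.
  rewrite /= /to_hoch (_ : chain_sum _ = chain_sum z); last first.
    by apply: eq_bigr => u _; rewrite cochain_ofK.
  by rewrite zw wy opprB addrC subrK.
apply/mem_gr_cochains => s; rewrite ds_makeE rpredZ // tcast_deg //.
rewrite /z; case: ifP => _; last exact: rpred0.
apply: (@moore_closed _ Y r r w (fun m => gr_deg (gr_tpow G m) j)) => // m i' x.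
  exact: face_deg.
exact: degen_deg.
Qed.

End PolygonCohomology.

(** * The theory in which the closing edge acts as the identity *)

Section PlainCohomology.
Variables (n : nat) (k : comNzRingType) (A : algType k) (G : grading A).
Local Notation N := n.+1.
Variable leE : rel 'I_N.
Hypotheses (leE_anti : antisymmetric leE) (leE_total : total leE).
Implicit Types (s u : {set 'I_N}) (e f : 'I_N).

Local Notation Phat := (@edge_map_hat N k A).
Local Notation Pplain := (@edge_map N k A).

Lemma coboundaries_hatE i x : (i <= n)%N ->
  (x \in coboundaries leE Phat i) <-> (x \in coboundaries leE Pplain i).
Proof.
case: i => [|i] i_n.
  have b0 Phi : (x \in coboundaries leE Phi 0) <-> x = 0.
    split=> [/mem_coboundaries[y y0 ->]|->]; last exact: rpred0.
    suff -> : y = 0 by rewrite linear0.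
    by apply/ds_eqP => s; rewrite y0 // linear0.
  by split=> /b0 ->; apply: rpred0.
split=> /mem_coboundariesS[y yi ->]; apply/mem_coboundariesS.
  exact: (ex_intro2 _ _ y yi (codiff_hat leE i_n yi)).
exact: (ex_intro2 _ _ y yi (esym (codiff_hat leE i_n yi))).
Qed.

Lemma cocycles_hatE i x : (i < n)%N ->
  (x \in cocycles leE Phat i) <-> (x \in cocycles leE Pplain i).
Proof.
move=> i_n; split=> /mem_cocycles[xi x0]; apply/mem_cocycles.
  exact: (conj xi (etrans (esym (codiff_hat leE i_n xi)) x0)).
exact: (conj xi (etrans (codiff_hat leE i_n xi) x0)).
Qed.

Lemma plain_hat_iso i : (i < n)%N ->
  gr_iso (graph_cohomology G leE i) (graph_cohomology_hat G leE i).
Proof.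
move=> i_n; apply: gr_subquot_eq_iso => x; apply: iff_sym.
  exact: cocycles_hatE.
exact: coboundaries_hatE (ltnW i_n).
Qed.

Lemma ncomp_full s : #|gaps s| = 0%N -> ncomp s = 1%N.
Proof.
move=> /eqP; rewrite cards_eq0 => /eqP g0.
have sE : s = state set0 by rewrite -g0 gapsK.
have cE (c : 'I_(ncomp s)) : c = comp_of s ord0.
  rewrite -[LHS]comp_vertexK; apply/eqP; rewrite comp_of_eq.
  move: (comp_vertex c) => v; rewrite sE connect_state.
  by rewrite cards0 !modn0 /rank !big_set0.
have n0 : (0 < ncomp s)%N by apply: leq_ltn_trans (ltn_ord (comp_of s ord0)).
apply/eqP; rewrite eqn_leq n0 andbT leqNgt; apply/negP => n1.
by have := etrans (cE (Ordinal n0)) (esym (cE (Ordinal n1))).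
Qed.

Lemma tcast_edge_map_last s e (x : states A s) : e \notin s -> #|gaps s| = 1%N ->
  tcast 1 (edge_map A s e x) = tcast 1 x.
Proof.
move=> es g1; have s1 : ncomp s = 1%N by rewrite ncompE g1.
have g0 : #|gaps (e |: s)| = 0%N by have := card_gaps_setU1 es; rewrite g1 => -[].
have same : same_comp s e.
  by rewrite /same_comp -val_eqE /= !comp_ofE g1 // !modn1.
move: x; apply: tpow_ext => [a y z|a y z|v].
- by rewrite 2!linearP.
- by rewrite linearP.
rewrite tcast_ntens // [edge_map A s e _]tens_liftE.
apply: tcast_tens => [|c]; first exact: ncomp_full.
rewrite mergeE same /= ffunE; congr (v _).
have := ltn_ord (comp_of s (comp_vertex c)); have := ltn_ord c.
by rewrite {2}s1 {2}(ncomp_full g0); lia.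
Qed.

Lemma sum_card1 (V : nmodType) (F : {set 'I_N} -> V) :
  (forall u, #|u| <> 1%N -> F u = 0) -> \sum_u F u = \sum_g F [set g].
Proof.
move=> F0; transitivity (\sum_(u in [set [set g] | g in [set: 'I_N]]) F u); last first.
  rewrite big_imset => [|g h _ _ /set1_inj //].
  by apply: eq_bigl => g; rewrite inE.
rewrite [RHS]big_mkcond; apply: eq_bigr => u _; case: imsetP => // nu.
by apply: F0 => /eqP/cards1P[g ug]; case: nu; exists g.
Qed.

(** The last plain differential is, up to sign, the sum [to_hoch leE 1]. A plain cocycle is thus a
    hatted cocycle with zero image in Hochschild homology, hence a hatted coboundary, and the
    coboundaries of the two theories agree. *)
Lemma plain_top x : (0 < n)%N -> x \in cocycles leE Pplain n -> x \in coboundaries leE Pplain n.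
Proof.
move=> n0 /mem_cocycles[xn x0]; apply: (coboundaries_hatE x (leqnn n)).1.
have xZ : x \in cocycles leE Phat n.
  (* Every cochain of degree [n] is a hatted cocycle. *)
  apply: (cocycles_hat leE_anti leE_total x (add0n n)).2; split; first exact: xn.
  by move=> u; rewrite /sbdry big1 // => g _; rewrite [face _ _ _ _]hface0 scaler0.
apply: (coboundaries_hat leE_anti leE_total (add0n n) n0 xZ).1.
suff -> : to_hoch leE 1 x = 0 by apply: rpred0.
have xs := chain_of_supported leE (add1n n) xn.
rewrite /to_hoch /chain_sum (sum_card1 xs) (reindex (@src N)) /=; last first.
  exact/onW_bij/(Bijective (@ord_predK _))/ordSK.
(* The coordinate of [codiff] at the full set of edges, where each closing map is the identity up to
   casts. *)
have := tcast_codiff leE Pplain setT 1 x.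
rewrite x0 [ds_coord _ 0]linear0 [tcast _ 0]linear0.
move=> /(congr1 (fun t => (-1) ^+ twist leE setT *: t)).
rewrite scaler0 scaler_sumr => /esym e0; rewrite -[RHS]e0.
apply: eq_big => [e|e _]; first by rewrite inE.
have es : e \notin setT :\ e by rewrite setD11.
have eE : e |: (setT :\ e) = setT by rewrite setD1K.
have gT : gaps [set: 'I_N] = set0 by apply/setP => p; rewrite !inE.
have sE : state [set src e] = setT :\ e.
  by apply/setP => f; rewrite !inE (inj_eq (@src_inj _)) andbT.
have g1 : #|gaps (setT :\ e)| = 1%N by rewrite -sE stateK cards1.
rewrite tcast_edge_map_last // scalerA /chain_of.
have := sign_twist k leE_anti leE_total es; rewrite eE gT => ->.
by rewrite [rank _ _]big_set0 mulr1 sE.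
Qed.

End PlainCohomology.

(** * Hochschild homology in degree zero *)

Section HHzero.
Variables (k : comNzRingType) (A : algType k) (G : grading A).

Lemma eval1_multilinear : multilinear (fun w : {ffun 'I_1 -> A} => w ord0 : A).
Proof. by move=> w i a x y; rewrite !ffunE [i]ord1 eqxx. Qed.

Definition eval1 : {linear tpow A 1 -> A} := tens_lift eval1_multilinear.

Lemma eval1_ntens v : eval1 (ntens 1 v) = v 0%N.
Proof. by rewrite [LHS]tens_liftE ffunE. Qed.

Definition tens1 (a : A) : tpow A 1 := ntens 1 (fun=> a).

Fact tens1_is_linear : linear tens1.
Proof.
move=> a x y; have E z : tens1 z = tens (upd [ffun=> 0] ord0 z).
  by congr tens; apply/ffunP => c; rewrite !ffunE [c]ord1.
by rewrite !E tens_multilinear.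
Qed.
HB.instance Definition _ := GRing.isLinear.Build k A (tpow A 1) *:%R tens1 tens1_is_linear.

Lemma tens1K : cancel tens1 eval1. Proof. by move=> a; rewrite eval1_ntens. Qed.

Lemma eval1K : cancel eval1 tens1.
Proof.
apply: (@tpow_ext _ _ _ _ _ id) => [a y z|a y z|v]; rewrite ?linearP // eval1_ntens.
by apply: eq_ntens => -[].
Qed.

Definition commutator (x : A) : Prop := exists a b : A, x = a * b - b * a.

Lemma bdry_ntens2 v :
  bdry (Y := hoch_simplicial A) (ntens 2 v : hoch_simplicial A 2) =
  tens1 (v 0%N * v 1%N - v 1%N * v 0%N).
Proof.
rewrite /bdry big_ord_recl big_ord1 expr0 scale1r expr1 scaleN1r.
rewrite [X in X - _]hface_ntens // [X in _ - X]hface_ntens // linearB.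
by congr (_ - _); apply: eq_ntens => -[].
Qed.

(** Both inclusions are checked on generators: pure tensors in one direction, commutators in the
    other. *)
Lemma mem_hoch_boundaries0 x :
  (x \in hoch_boundaries A 0) <-> eval1 x \in submod_span commutator.
Proof.
split=> [/mem_hoch_boundaries[y ->]|xc].
  pose f (t : tpow A 2) : A := eval1 (bdry (Y := hoch_simplicial A) t).
  have fl : linear f.
    move=> a t t'; have e := @bdry_is_linear _ (hoch_simplicial A) 1 a t t'.
    exact: etrans (congr1 eval1 e) (linearP eval1 a _ _).
  rewrite -/(f y); elim/tens_ind: y => [|a w t IH].
    by have := fl (-1) 0 0; rewrite !scaleN1r oppr0 addr0 addNr => ->; apply: rpred0.
  have [v ->] := tens_ntens w; rewrite fl; apply: rpredD IH; apply: rpredZ.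
  rewrite /f bdry_ntens2 tens1K.
  by apply: submod_span_gen; exists (v 0%N), (v 1%N).
rewrite -(eval1K x); apply: submod_span_map xc => _ [a [b ->]].
apply/mem_hoch_boundaries; exists (ntens 2 (fun c => if c == 0%N then a else b)).
by rewrite bdry_ntens2.
Qed.

(** Serves twice: with the projection onto the cocenter and, for commutative [A], with the identity
    of [A]. *)
Lemma HH0_iso (W : grmod k) (q : {linear A -> W}) :
  (forall a, q a = 0 <-> a \in submod_span commutator) ->
  (forall j w, w \in gr_deg W j -> exists2 a, a \in G j & q a = w) ->
  (forall w, exists a, q a = w) ->
  (forall j a, a \in G j -> q a \in gr_deg W j) ->
  gr_iso (HH G 0) W.
Proof.
move=> q0 qds qs qd; pose g (x : submod (hoch_cycles A 0)) : W := q (eval1 (val x)).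
have gl : linear g.
  move=> a x y; have e : val (a *: x + y) = a *: val x + val y by rewrite linearP.
  by rewrite /g e 2!linearP.
pose gL := GRing.isLinear.Build k _ _ *:%R g gl.
(* The boundary out of C_0 is zero by definition. *)
have cyc x : x \in hoch_cycles A 0 by apply/submodule_ofE.
have tK a : g (in_submod (cyc (tens1 a))) = q a by rewrite /g /= tens1K.
apply: (@gr_subquot_iso _ (gr_tpow G 1) _ _ _ (HB.pack g gL)) => [x|w|j x xd|j w].
- by apply: (iff_trans (q0 _)); split=> /mem_hoch_boundaries0.
- by have [a <-] := qs w; exists (in_submod (cyc (tens1 a))).
- apply: qd; apply: tpow_deg_map xd => v dg vd <-.
  by rewrite eval1_ntens big_nat1 vd.
case/qds => a ad <-; exists (in_submod (cyc (tens1 a))) => //=.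
have := @ntens_deg _ _ G 1 (fun=> a) (fun=> j) (fun _ _ => ad).
by rewrite big_nat1.
Qed.

Lemma HH0_cocenter : gr_iso (HH G 0) (gr_cocenter G).
Proof.
pose q : {linear A -> gr_cocenter G} := quot_pi (submod_span commutator).
apply: (@HH0_iso _ q) => [a|j w|w|j a aj].
- rewrite -[a in _ <-> a \in _]subr0; split=> [a0|/quot_piP e].
    by apply/quot_piP; apply: etrans a0 (esym (linear0 q)).
  exact: etrans e (linear0 q).
- by case/mem_quot_image => a aj ->; exists a.
- by exists (repr w); apply: quot_pi_reprK.
- by apply/mem_quot_image; exists a.
Qed.

Lemma HH0_commutative : (forall a b : A, a * b = b * a) -> gr_iso (HH G 0) (gr_alg G).
Proof.
move=> AC; apply: (@HH0_iso (gr_alg G) (idfun : {linear A -> A})) => [a|j w wj|w|//].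
- split=> [a0|]; first by rewrite (a0 : a = 0); apply: rpred0.
  have P0 : 0 = 0 :> A by [].
  have PL b x y : x = 0 -> y = 0 -> b *: x + y = 0 :> A by move=> -> ->; rewrite scaler0 addr0.
  move=> /submod_spanP ac; apply/(submodule_ofE P0 PL)/ac => _ [b [c ->]].
  by apply/submodule_ofE; rewrite AC subrr.
- by exists w.
- by exists w.
Qed.

End HHzero.

Theorem corollary3p2 (k : comNzRingType) (A : algType k) (G : grading A)
  (n : nat) (leE : rel 'I_n.+1) :
  free_module A ->
  (1 <= n)%N ->
  antisymmetric leE -> transitive leE -> total leE ->
  [/\ forall (i : nat) (j : int), (0 < i <= n)%N ->
        lmod_iso (deg_part (graph_cohomology_hat G leE i) j) (deg_part (HH G (n - i)) j),
      (forall a b : A, a * b = b * a) ->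
        [/\ forall (i : nat) (j : int), (0 < i < n)%N ->
              lmod_iso (deg_part (graph_cohomology G leE i) j) (deg_part (graph_cohomology_hat G leE i) j),
            forall x : graph_cohomology G leE n, x = 0,
            gr_iso (graph_cohomology_hat G leE n) (HH G 0)
          & gr_iso (HH G 0) (gr_alg G)]
    & gr_iso (graph_cohomology_hat G leE n) (HH G 0) /\ gr_iso (HH G 0) (gr_cocenter G)].
Proof.
move=> _ n1 leE_anti _ leE_total.
have top := hat_iso G leE_anti leE_total (add0n n) n1.
split=> [i j /andP[i0 i_n]|AC|]; last by split=> //; apply: HH0_cocenter.
  by apply/gr_iso_deg_part/hat_iso; rewrite ?subnK.
split=> // [i j /andP[_ i_n]|x|]; last exact: HH0_commutative.
  exact/gr_iso_deg_part/plain_hat_iso.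
rewrite -(quot_pi_reprK x) -[RHS](linear0 (quot_pi _)); apply/quot_piP.
rewrite subr0; apply/mem_submod_restrict/plain_top => //.
exact: (valP (repr x)).
Qed.
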